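(* Let $X$, $X'$ be multispindles, $M$ an $X'$-module, and $\varphi\colon X\to X'$ a multispindle homomorphism inducing an isomorphism $\varphi_*\colon H^N(M^\varphi;X)\to H^N(M;X')$. If $\varphi$ also induces an isomorphism $\varphi_*\colon H^N(N^\varphi;X)\to H^N(N;X')$ for any $X'$-module $N$ with a vanishing compound action, then $\varphi_*\colon H^D(M^\varphi;X)\to H^D(M;X')$ is an isomorphism.
   Context: Let $R$ be a commutative ring with unit. A spindle is a set $X$ with a binary operation $\star$ such that $x\star x=x$ and $(x\star y)\star z=(x\star z)\star(y\star z)$; it is a quandle if every map $x\mapsto x\star y$ is invertible. A multispindle $(X;\star_1,\dots,\star_r)$ is a set with spindle operations satisfying $(x\star_i y)\star_j z=(x\star_j z)\star_i(y\star_j z)$ for all $i,j$. A homomorphism of multispindles (with the same number $r$ of operations) is a map preserving each operation. An $X$-module is an $R$-module $M$ with functions $\star_i\colon M\times X\to M$, linear in the first variable, with $(m\star_i x)\star_j y=(m\star_j y)\star_i(x\star_j y)$ (for a quandle $(X,\star)$ one also requires each $m\mapsto m\star x$ to be invertible). Fix weights $a_1,\dots,a_r\in R$, the same for $X$ and $X'$. The compound action is $m\cdot x:=\sum_k a_k(m\star_k x)$; it vanishes if $m\cdot x=0$ for all $m,x$. Given a homomorphism $\varphi\colon X\to X'$ and an $X'$-module $M$, $M^\varphi$ is $M$ with the $X$-action $m\star_i x:=m\star_i\varphi(x)$. $C_n(M;X)=M\otimes R\langle X^{n+1}\rangle$ for $n\ge0$, on sequences $(x_n,\dots,x_0)$,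 with $\partial=\sum_k a_k\sum_{i=0}^n(-1)^{n-i}d_i^{\star_k}$, $d_i^{\star_k}(m\otimes(x_n,\dots,x_0))=(m\star_k x_i)\otimes(x_n\star_k x_i,\dots,x_{i+1}\star_k x_i,x_{i-1},\dots,x_0)$. $C^D(M;X)$ is the subcomplex spanned by generators with $x_i=x_{i+1}$ for some $i$, and $C^N=C/C^D$; their homologies are $H^D(M;X)$ and $H^N(M;X)$. The maps $\varphi_*$ are induced by $m\otimes(x_n,\dots,x_0)\mapsto m\otimes(\varphi(x_n),\dots,\varphi(x_0))$. *)

(* Defs.v *)
From HB Require Import structures.
From mathcomp Require Import all_boot all_algebra finmap.
From mathcomp Require Import monalg.
From mathcomp Require Import boolp zify.

Set Implicit Arguments.
Unset Strict Implicit.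
Unset Printing Implicit Defensive.

Import GRing.Theory.
Local Open Scope ring_scope.

Section Submodules.
Variables (R : pzRingType) (V : lmodType R) (W : submodClosed V).

Record submod : Type := Submod { submod_val :> V; _ : submod_val \in W }.

HB.instance Definition _ := [isSub for submod_val].
HB.instance Definition _ := [Choice of submod by <:].
HB.instance Definition _ := [SubChoice_isSubLmodule of submod by <:].

Fact submod_oppr_closed : oppr_closed W.
Proof. exact: GRing.zmod_closedN (submodClosedP W). Qed.

Definition submod_zmodClosed : zmodClosed V :=
  HB.pack (W : {pred V})
    (GRing.isOppClosed.Build V W submod_oppr_closed)
    (GRing.SubmodClosed.on (W : {pred V})).

Let Q : Type := Quotient.quot submod_zmodClosed.

Definition quotmod : Type := Q.

HB.instance Definition _ := GRing.Zmodule.on quotmod.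

Definition qproj (x : V) : quotmod := \pi_Q%qT x.
Definition qrepr (q : quotmod) : V := repr (q : Q).

Lemma qreprK q : qproj (qrepr q) = q.
Proof. exact: reprK. Qed.

Lemma qproj_eq x y : (qproj x = qproj y) <-> (x - y \in W).
Proof.
have -> : (x - y \in W) = (x - y \in submod_zmodClosed) by [].
by rewrite Quotient.idealrBE; split=> [e|/eqP //]; apply/eqP; exact: e.
Qed.

Lemma qproj_eq0 x : (qproj x = 0) <-> (x \in W).
Proof.
rewrite -[x in x \in W]subr0 -qproj_eq.
suff -> : qproj 0 = 0 by [].
exact: (raddf0 \pi_Q%qT).
Qed.

Fact qproj_zmod : zmod_morphism qproj.
Proof. exact: (raddfB \pi_Q%qT). Qed.

HB.instance Definition _ :=
  GRing.isZmodMorphism.Build V quotmod qproj qproj_zmod.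

Definition qscale (a : R) (q : quotmod) : quotmod := qproj (a *: qrepr q).

Lemma qscale_proj a x : qscale a (qproj x) = qproj (a *: x).
Proof.
by apply/qproj_eq; rewrite -scalerBr rpredZ //; apply/qproj_eq; rewrite qreprK.
Qed.

Fact qscaleA a b q : qscale a (qscale b q) = qscale (a * b) q.
Proof. by rewrite -[q]qreprK !qscale_proj scalerA. Qed.

Fact qscale1 : left_id 1 qscale.
Proof. by move=> q; rewrite -[q]qreprK !qscale_proj scale1r. Qed.

Fact qscaleDr : right_distributive qscale +%R.
Proof.
move=> a p q; rewrite -[p]qreprK -[q]qreprK -raddfD !qscale_proj.
by rewrite -raddfD scalerDr.
Qed.

Fact qscaleDl q : {morph qscale^~ q : a b / a + b}.
Proof. by move=> a b; rewrite -[q]qreprK !qscale_proj scalerDl raddfD. Qed.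

HB.instance Definition _ := GRing.Zmodule_isLmodule.Build R quotmod
  qscaleA qscale1 qscaleDr qscaleDl.

Fact qproj_scalable : scalable qproj.
Proof. by move=> a x; rewrite -qscale_proj. Qed.

HB.instance Definition _ :=
  GRing.isScalable.Build R V quotmod *:%R qproj qproj_scalable.

End Submodules.

Section InducedMaps.
Variables (R : pzRingType) (V V' : lmodType R).
Variables (W : submodClosed V) (W' : submodClosed V') (f : {linear V -> V'}).
Hypothesis fW : forall x, x \in W -> f x \in W'.

Definition sub_map (x : submod W) : submod W' := Submod (fW (valP x)).

Fact sub_map_linear : linear sub_map.
Proof. by move=> a x y; apply: val_inj; rewrite /= linearP. Qed.

HB.instance Definition _ :=
  GRing.isLinear.Build R (submod W) (submod W') *:%R sub_map sub_map_linear.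

(* The unused argument lets the linear structure below find its hypothesis. *)
Definition quot_map of (forall x, x \in W -> f x \in W') :=
  fun q : quotmod W => qproj W' (f (qrepr q)).

Local Notation qmap := (quot_map fW).

Lemma quot_map_proj x : qmap (qproj W x) = qproj W' (f x).
Proof. by apply/qproj_eq; rewrite -linearB fW //; apply/qproj_eq; rewrite qreprK. Qed.

Fact quot_map_linear : linear qmap.
Proof.
move=> a p q; rewrite -[p]qreprK -[q]qreprK.
by rewrite -linearP !quot_map_proj !linearP.
Qed.

HB.instance Definition _ :=
  GRing.isLinear.Build R (quotmod W) (quotmod W') *:%R qmap quot_map_linear.

End InducedMaps.

Arguments sub_map {R V V' W W' f} fW x.
Arguments quot_map {R V V' W W' f} fW q.

Section Complexes.
Variable R : pzRingType.

Record complex := Complex {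
  cobj :> nat -> lmodType R;
  cdiff : forall n, {linear cobj n.+1 -> cobj n};
  cdiffK : forall n (x : cobj n.+2), cdiff n (cdiff n.+1 x) = 0 }.

Record chain_map (C D : complex) := ChainMap {
  cmap :> forall n, {linear C n -> D n};
  cmapE : forall n (x : C n.+1), cmap n (cdiff C n x) = cdiff D n (cmap n.+1 x) }.

Record subcomplex (C : complex) := Subcomplex {
  scobj :> forall n, submodClosed (C n);
  scdiff : forall n x, x \in scobj n.+1 -> cdiff C n x \in scobj n }.

Section SubQuotient.
Variables (C : complex) (S : subcomplex C).

Fact sub_complexK n (x : submod (S n.+2)) :
  sub_map (@scdiff _ S n) (sub_map (@scdiff _ S n.+1) x) = 0.
Proof. by apply: val_inj; rewrite /= cdiffK. Qed.

Definition sub_complex := @Complex (fun n => submod (S n))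
  (fun n => sub_map (@scdiff _ S n)) sub_complexK.

Fact quot_complexK n (q : quotmod (S n.+2)) :
  quot_map (@scdiff _ S n) (quot_map (@scdiff _ S n.+1) q) = 0.
Proof. by rewrite -[q]qreprK !quot_map_proj cdiffK linear0. Qed.

Definition quot_complex := @Complex (fun n => quotmod (S n))
  (fun n => quot_map (@scdiff _ S n)) quot_complexK.

End SubQuotient.

Section SubQuotientMaps.
Variables (C D : complex) (S : subcomplex C) (T : subcomplex D).
Variable f : chain_map C D.
Hypothesis fS : forall n x, x \in S n -> f n x \in T n.

Fact sub_chain_mapE n (x : sub_complex S n.+1) :
  sub_map (@fS n) (cdiff (sub_complex S) n x)
    = cdiff (sub_complex T) n (sub_map (@fS n.+1) x).
Proof. by apply: val_inj; rewrite /= cmapE. Qed.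

Definition sub_chain_map : chain_map (sub_complex S) (sub_complex T) :=
  @ChainMap (sub_complex S) (sub_complex T)
    (fun n => sub_map (@fS n)) sub_chain_mapE.

Fact quot_chain_mapE n (q : quot_complex S n.+1) :
  quot_map (@fS n) (cdiff (quot_complex S) n q)
    = cdiff (quot_complex T) n (quot_map (@fS n.+1) q).
Proof. by rewrite -[q]qreprK /= !quot_map_proj cmapE. Qed.

Definition quot_chain_map : chain_map (quot_complex S) (quot_complex T) :=
  @ChainMap (quot_complex S) (quot_complex T)
    (fun n => quot_map (@fS n)) quot_chain_mapE.

End SubQuotientMaps.

Section Homology.
Variable C : complex.

(* The complex is 0 in degree -1, so every 0-chain is a cycle. *)
Definition cycle n : {pred C n} :=
  match n with
  | 0 => predT
  | n'.+1 => fun x : C n'.+1 => cdiff C n' x == 0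
  end.

Fact cycle_closed n : submod_closed (@cycle n).
Proof.
case: n => [|n]; first by [].
split=> [|a x y]; rewrite !unfold_in /=; first by rewrite linear0.
by rewrite linearP => /eqP-> /eqP->; rewrite scaler0 addr0.
Qed.

HB.instance Definition _ n :=
  GRing.isSubmodClosed.Build R (C n) (@cycle n) (cycle_closed n).

Definition boundary n : {pred submod (@cycle n)} :=
  fun z => `[< exists x, val z = cdiff C n x >].

Fact boundary_closed n : submod_closed (@boundary n).
Proof.
split=> [|a y z]; rewrite !unfold_in.
  by apply/asboolP; exists 0; rewrite linear0.
move=> /asboolP[u yE] /asboolP[v zE]; apply/asboolP.
by exists (a *: u + v); rewrite linearP -yE -zE.
Qed.

HB.instance Definition _ n :=
  GRing.isSubmodClosed.Build R (submod (@cycle n)) (@boundary n)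
    (boundary_closed n).

Definition homology n : lmodType R := quotmod (@boundary n).

End Homology.

Section HomologyMap.
Variables (C D : complex) (f : chain_map C D).

Fact cycle_map n x : x \in @cycle C n -> f n x \in @cycle D n.
Proof.
case: n x => [//|n] x; rewrite !unfold_in /= => /eqP dx0.
by rewrite -cmapE dx0 linear0.
Qed.

Fact boundary_map n z :
  z \in @boundary C n -> sub_map (@cycle_map n) z \in @boundary D n.
Proof.
rewrite !unfold_in => /asboolP[x zE]; apply/asboolP.
by exists (f n.+1 x); rewrite -cmapE -zE.
Qed.

Definition homology_map n : {linear homology C n -> homology D n} :=
  quot_map (@boundary_map n).

End HomologyMap.
End Complexes.

(* M ⊗ R<K>, written as the direct sum of copies of M indexed by K; *)
(* << m *g k >> stands for m ⊗ k.                                   *)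
Section FreeTensor.
Variables (R : pzRingType) (M : lmodType R) (K : choiceType).

Definition tensor_free : Type := {malg M[K]}.

HB.instance Definition _ := GRing.Zmodule.on tensor_free.

Implicit Types c d : tensor_free.

Definition tscale (a : R) c : tensor_free :=
  [malg k in msupp c => a *: c@_k].

Lemma tscaleE a c k : (tscale a c)@_k = a *: c@_k.
Proof.
by rewrite mcoeffE; case: msuppP => // _; rewrite scaler0.
Qed.

Fact tscaleA a b c : tscale a (tscale b c) = tscale (a * b) c.
Proof. by apply/malgP => k; rewrite !tscaleE scalerA. Qed.

Fact tscale1 : left_id 1 tscale.
Proof. by move=> c; apply/malgP => k; rewrite tscaleE scale1r. Qed.

Fact tscaleDr : right_distributive tscale +%R.
Proof.
by move=> a c d; apply/malgP => k; rewrite mcoeffD !tscaleE mcoeffD scalerDr.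
Qed.

Fact tscaleDl c : {morph tscale^~ c : a b / a + b}.
Proof. by move=> a b; apply/malgP => k; rewrite mcoeffD !tscaleE scalerDl. Qed.

HB.instance Definition _ := GRing.Zmodule_isLmodule.Build R tensor_free
  tscaleA tscale1 tscaleDr tscaleDl.

Lemma tcoeffZ a c k : (a *: c)@_k = a *: c@_k.
Proof. exact: tscaleE. Qed.

End FreeTensor.

HB.lock Definition pure (R : pzRingType) (M : lmodType R) (K : choiceType)
  (k : K) (m : M) : tensor_free M K := << m *g k >>.

HB.lock Definition tensor_ext (R : pzRingType) (M : lmodType R) (K : choiceType)
    (V : lmodType R) (g : K -> {linear M -> V}) (c : tensor_free M K) : V :=
  \sum_(k <- msupp c) g k c@_k.

Section Extension.
Variables (R : pzRingType) (M : lmodType R) (K : choiceType).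

Fact pure_linear k : linear (@pure R M K k).
Proof.
move=> a m1 m2; rewrite !pure.unlock; apply/malgP => k'.
by rewrite mcoeffD tcoeffZ !mcoeffU mulrnDl scalerMnr.
Qed.

HB.instance Definition _ k :=
  GRing.isLinear.Build R M (tensor_free M K) *:%R (pure k) (pure_linear k).

Variables (V : lmodType R) (g : K -> {linear M -> V}).

Lemma tensor_extEw (d : {fset K}) (c : tensor_free M K) : (msupp c `<=` d)%fset ->
  tensor_ext g c = \sum_(k <- d) g k c@_k.
Proof.
move=> le_cd; rewrite tensor_ext.unlock; apply: big_fset_incl => // k _ /mcoeff_outdom->.
by rewrite linear0.
Qed.

Fact tensor_ext_linear : linear (tensor_ext g).
Proof.
move=> a c d; pose s := (msupp (a *: c + d) `|` (msupp c `|` msupp d))%fset.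
have s1 : (msupp (a *: c + d) `<=` s)%fset by exact: fsubsetUl.
have s2 : (msupp c `<=` s)%fset by rewrite fsubsetU ?fsubsetUl ?orbT.
have s3 : (msupp d `<=` s)%fset by rewrite fsubsetU ?fsubsetUr ?orbT.
rewrite (tensor_extEw s1) (tensor_extEw s2) (tensor_extEw s3) scaler_sumr -big_split.
by apply: eq_bigr => k _ /=; rewrite mcoeffD tcoeffZ linearP.
Qed.

HB.instance Definition _ :=
  GRing.isLinear.Build R (tensor_free M K) V *:%R (tensor_ext g) tensor_ext_linear.

Lemma tensor_ext_pure k m : tensor_ext g (pure k m) = g k m.
Proof.
rewrite (@tensor_extEw [fset k]%fset) pure.unlock ?msuppU_le // big_seq_fset1.
by rewrite mcoeffUU.
Qed.

End Extension.

Lemma tensor_ind (R : pzRingType) (M : lmodType R) (K : choiceType)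
    (P : tensor_free M K -> Prop) :
    P 0 -> (forall k m c, P c -> P (pure k m + c)) -> forall c, P c.
Proof.
move=> P0 PD c; rewrite [c]monalgE.
elim: (enum_fset (msupp c)) => [|k s IHs]; first by rewrite big_nil.
rewrite big_cons; have := PD k c@_k _ IHs; rewrite pure.unlock; exact.
Qed.

Section Multispindles.
Variable r : nat.

Record multispindle := Multispindle {
  ms_sort :> choiceType;
  ms_op : 'I_r -> ms_sort -> ms_sort -> ms_sort;
  ms_idem : forall i x, ms_op i x x = x;
  ms_distr : forall i j x y z,
    ms_op j (ms_op i x y) z = ms_op i (ms_op j x z) (ms_op j y z) }.

Definition is_quandle (X : multispindle) : Prop :=
  forall i y, bijective (fun x : X => ms_op i x y).

Record ms_hom (X X' : multispindle) := MsHom {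
  ms_fun :> X -> X';
  ms_funE : forall i x y, ms_fun (ms_op i x y) = ms_op i (ms_fun x) (ms_fun y) }.

Variable R : comPzRingType.

(* m ⋆_i x is written xact i x m. *)
Record xmodule (X : multispindle) := XModule {
  xm_sort :> lmodType R;
  xact : 'I_r -> X -> {linear xm_sort -> xm_sort};
  xactE : forall i j x y m,
    xact j y (xact i x m) = xact i (ms_op j x y) (xact j y m) }.

(* Required of a module only when X is regarded as a quandle. *)
Definition has_invertible_action (X : multispindle) (M : xmodule X) : Prop :=
  forall i x, bijective (xact M i x).

Definition compound (a : 'I_r -> R) (X : multispindle) (M : xmodule X)
    (m : M) (x : X) : M :=
  \sum_(k < r) a k *: xact M k x m.

Definition vanishing_compound a X (M : xmodule X) : Prop :=
  forall m x, compound a m x = 0 :> M.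

Fact pullback_actE (X X' : multispindle) (phi : ms_hom X X') (M : xmodule X')
    i j x y m :
  xact M j (phi y) (xact M i (phi x) m)
    = xact M i (phi (ms_op j x y)) (xact M j (phi y) m).
Proof. by rewrite ms_funE xactE. Qed.

Definition pullback X X' (phi : ms_hom X X') (M : xmodule X') : xmodule X :=
  @XModule X M (fun i x => xact M i (phi x)) (pullback_actE phi (M := M)).

End Multispindles.

Arguments xact {r R X M} i x : rename.

Section Faces.
Variables (r : nat) (X : multispindle r).

(* A sequence (x_{n-1}, ..., x_0) is the function i |-> x_i. *)
Definition face_seq n (k : 'I_r) (i : 'I_n.+1) (x : {ffun 'I_n.+1 -> X}) :
    {ffun 'I_n -> X} :=
  [ffun j : 'I_n =>
    if (i <= j)%N then ms_op k (x (lift i j)) (x i) else x (lift i j)].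

Definition degenerate n (x : {ffun 'I_n -> X}) : bool :=
  [exists i : 'I_n, exists j : 'I_n, (j == i.+1 :> nat) && (x i == x j)].

Lemma face_seq_comm n k l (i j : 'I_n.+1) (x : {ffun 'I_n.+2 -> X}) : (i <= j)%N ->
  face_seq k i (face_seq l (lift ord0 j) x)
    = face_seq l j (face_seq k (widen_ord (leqnSn _) i) x).
Proof.
move=> le_ij; apply/ffunP => t; rewrite !ffunE.
have e1 : lift (lift ord0 j) (lift i t)
    = lift (widen_ord (leqnSn _) i) (lift j t) :> 'I_n.+2.
  by apply: ord_inj; rewrite /= /bump; lia.
have e2 : lift (lift ord0 j) i = widen_ord (leqnSn _) i :> 'I_n.+2.
  by apply: ord_inj; rewrite /= /bump; lia.
have e3 : lift (widen_ord (leqnSn _) i) j = lift ord0 j :> 'I_n.+2.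
  by apply: ord_inj; rewrite /= /bump; lia.
rewrite e1 e2 e3 /=.
have -> : (bump 0 j <= bump i t)%N = (j <= t)%N by rewrite /bump; lia.
have -> : (i <= bump j t)%N = (i <= t)%N by rewrite /bump; lia.
have -> : (bump 0 j <= i)%N = false by rewrite /bump; lia.
rewrite le_ij; case: (leqP j t) => [le_jt|//].
by rewrite (leq_trans le_ij le_jt) ms_distr.
Qed.

Lemma face_seq_deg n k (p q i : 'I_n.+1) (x : {ffun 'I_n.+1 -> X}) :
  q = p.+1 :> nat -> x p = x q -> i != p -> i != q ->
  degenerate (face_seq k i x).
Proof.
move=> qE xpq ip iq.
case: (unliftP i p) => [p' pE|pE]; last by rewrite pE eqxx in ip.
case: (unliftP i q) => [q' q'E|q'E]; last by rewrite q'E eqxx in iq.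
have pv : p = bump i p' :> nat by rewrite pE.
have qv : q = bump i q' :> nat by rewrite q'E.
have q'p' : q' = p'.+1 :> nat by move: pv qv; rewrite qE /bump; lia.
have le_iq' : (i <= q')%N = (i <= p')%N by move: pv qv; rewrite qE /bump; lia.
apply/existsP; exists p'; apply/existsP; exists q'.
by rewrite !ffunE -pE -q'E xpq [(i <= q')%N]le_iq' eqxx andbT; apply/eqP.
Qed.

Lemma face_seq_eq n k (p q : 'I_n.+1) (x : {ffun 'I_n.+1 -> X}) :
  q = p.+1 :> nat -> x p = x q -> face_seq k p x = face_seq k q x.
Proof.
move=> qE xpq; apply/ffunP => t; rewrite !ffunE xpq.
case: (ltngtP p t) => [lt_pt|lt_tp|eq_pt].
- have -> : lift p t = lift q t by apply: ord_inj; rewrite /= /bump; lia.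
  by rewrite qE lt_pt.
- have -> : lift p t = lift q t by apply: ord_inj; rewrite /= /bump; lia.
  by rewrite leqNgt qE ltnS (ltnW lt_tp).
- have -> : lift p t = q by apply: ord_inj; rewrite /= /bump qE -eq_pt leqnn.
  have -> : lift q t = p by apply: ord_inj; rewrite /= /bump qE -eq_pt ltnn.
  by rewrite qE eq_pt ltnn xpq ms_idem.
Qed.

End Faces.

Section ChainComplex.
Variables (r : nat) (R : comPzRingType) (a : 'I_r -> R).
Variables (X : multispindle r) (M : xmodule R X).

(* Indexed by the length of the sequences, so C_n(M;X) is chains n.+1. *)
Definition chains n : lmodType R := tensor_free M {ffun 'I_n -> X}.

Definition face n k (i : 'I_n.+1) : chains n.+1 -> chains n :=
  tensor_ext (fun x => pure (face_seq k i x) \o xact k (x i)).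

Fact face_linear n k i : linear (@face n k i).
Proof. by move=> b c d; rewrite /face linearP. Qed.

HB.instance Definition _ n k i :=
  GRing.isLinear.Build R (chains n.+1) (chains n) *:%R (@face n k i)
    (@face_linear n k i).

Lemma faceD n k i c d : @face n k i (c + d) = face k i c + face k i d.
Proof. exact: linearD. Qed.

Lemma face0 n k i : @face n k i 0 = 0.
Proof. exact: linear0. Qed.

Lemma face_pure n k i x m :
  @face n k i (pure x m) = pure (face_seq k i x) (xact k (x i) m).
Proof. by rewrite /face tensor_ext_pure. Qed.

Lemma face_comm n k l (i j : 'I_n.+1) (c : chains n.+2) : (i <= j)%N ->
  face k i (face l (lift ord0 j) c)
    = face l j (face k (widen_ord (leqnSn _) i) c).
Proof.
move=> le_ij; elim/tensor_ind: c => [|x m c IHc]; first by rewrite !face0.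
rewrite (faceD l) (faceD k i) (faceD k _ (pure x m)) (faceD l j) IHc.
congr (_ + _); rewrite (face_pure l) (face_pure k i) (face_pure k) (face_pure l j).
have e2 : lift (lift ord0 j) i = widen_ord (leqnSn _) i :> 'I_n.+2.
  by apply: ord_inj; rewrite /= /bump; lia.
have e3 : lift (widen_ord (leqnSn _) i) j = lift ord0 j :> 'I_n.+2.
  by apply: ord_inj; rewrite /= /bump; lia.
rewrite face_seq_comm // !ffunE e2 e3 /= le_ij.
have -> : (bump 0 j <= i)%N = false by rewrite /bump; lia.
by rewrite xactE.
Qed.

Definition face_sum n k (c : chains n.+1) : chains n :=
  \sum_(i < n.+1) (-1) ^+ (n - i) *: face k i c.

Fact face_sum_linear n k : linear (@face_sum n k).
Proof.
move=> b c d; rewrite /face_sum scaler_sumr -big_split; apply: eq_bigr => i _ /=.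
by rewrite linearP scalerDr !scalerA [b * _]mulrC.
Qed.

HB.instance Definition _ n k :=
  GRing.isLinear.Build R (chains n.+1) (chains n) *:%R (@face_sum n k)
    (@face_sum_linear n k).

Definition bdry n (c : chains n.+1) : chains n :=
  \sum_(k < r) a k *: face_sum k c.

Fact bdry_linear n : linear (@bdry n).
Proof.
move=> b c d; rewrite /bdry scaler_sumr -big_split; apply: eq_bigr => k _ /=.
by rewrite linearP scalerDr !scalerA [b * _]mulrC.
Qed.

HB.instance Definition _ n :=
  GRing.isLinear.Build R (chains n.+1) (chains n) *:%R (@bdry n) (@bdry_linear n).

Let A n k l (c : chains n.+2) := \sum_(i < n.+1) \sum_(j < n.+1 | (i <= j)%N)
  (-1) ^+ (n - i + (n - j)) *: face k i (face l (lift ord0 j) c).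

Lemma face_sumK n k l (c : chains n.+2) :
  face_sum k (face_sum l c) = A k l c - A l k c.
Proof.
have step (i : 'I_n.+1) : (-1) ^+ (n - i) *: face k i (face_sum l c) =
    \sum_(j < n.+1 | (i <= j)%N)
       (-1) ^+ (n - i + (n - j)) *: face k i (face l (lift ord0 j) c)
  + \sum_(j < n.+1 | (j <= i)%N)
       (-1) ^+ (n - i + (n.+1 - j)) *:
         face k i (face l (widen_ord (leqnSn _) j) c).
  rewrite /face_sum linear_sum scaler_sumr.
  rewrite (bigID (fun j : 'I_n.+2 => (i < j)%N)) /=; congr (_ + _).
    rewrite big_mkcond big_ord_recl /= add0r -big_mkcond /=.
    by apply: eq_bigr => j _; rewrite linearZ scalerA exprD.
  rewrite big_mkcond big_ord_recr /= ltn_ord addr0 -big_mkcond /=.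
  apply: eq_big => [j|j _]; first by rewrite -leqNgt.
  by rewrite linearZ scalerA exprD.
rewrite {1}/face_sum (eq_bigr _ (fun i _ => step i)) big_split; congr (_ + _).
rewrite (exchange_big_dep predT) //= -sumrN; apply: eq_bigr => j _.
rewrite -sumrN; apply: eq_bigr => i le_ji.
rewrite (face_comm l k c le_ji) subSn ?(ltnW (ltn_ord j)) ?leq_ord //.
by rewrite addnS exprS mulN1r scaleNr addnC.
Qed.

Lemma bdryK n (c : chains n.+2) : bdry (bdry c) = 0.
Proof.
have -> : bdry (bdry c) =
    \sum_(k < r) \sum_(l < r) (a k * a l) *: (A k l c - A l k c).
  apply: eq_bigr => k _; rewrite {1}/bdry (linear_sum (@face_sum n k)) scaler_sumr.
  by apply: eq_bigr => l _; rewrite linearZ scalerA -face_sumK.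
have -> : \sum_(k < r) \sum_(l < r) (a k * a l) *: (A k l c - A l k c)
  = \sum_(k < r) \sum_(l < r) (a k * a l) *: A k l c
    - \sum_(k < r) \sum_(l < r) (a l * a k) *: A l k c.
  rewrite -sumrB; apply: eq_bigr => k _; rewrite -sumrB; apply: eq_bigr => l _.
  by rewrite scalerBr [a l * _]mulrC.
by rewrite [X in _ - X]exchange_big subrr.
Qed.

Definition chain_complex : complex R :=
  @Complex R (fun n => chains n.+1) (fun n => @bdry n.+1)
    (fun n => @bdryK n.+1).

(* The span of the m ⊗ x with x degenerate, see degen_span. *)
Definition degen n : {pred chains n} :=
  fun c => all (@degenerate r X n) (enum_fset (msupp c)).

Lemma degenP n (c : chains n) :
  reflect (forall x, ~~ degenerate x -> c@_x = 0) (c \in @degen n).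
Proof.
rewrite unfold_in; apply: (iffP allP) => [cD x xN|cD x].
  by apply: mcoeff_outdom; apply: contra xN; exact: cD.
by rewrite -mcoeff_neq0; apply: contraR => /cD->.
Qed.

Fact degen_closed n : submod_closed (@degen n).
Proof.
split=> [|b c d /degenP cD /degenP dD]; apply/degenP => x xN.
  exact: mcoeff0.
by rewrite mcoeffD tcoeffZ cD // dD // scaler0 addr0.
Qed.

HB.instance Definition _ n :=
  GRing.isSubmodClosed.Build R (chains n) (@degen n) (degen_closed n).

Lemma pure_degen n (x : {ffun 'I_n -> X}) m :
  degenerate x -> pure x m \in @degen n.
Proof.
move=> xD; apply/degenP => y yN; rewrite pure.unlock mcoeffU.
by case: eqP => // xy; rewrite -xy xD in yN.
Qed.

Lemma degen_span n (c : chains n) :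
  c \in @degen n <->
  exists2 s : seq ({ffun 'I_n -> X} * M),
    all (fun xm => degenerate xm.1) s & c = \sum_(xm <- s) pure xm.1 xm.2.
Proof.
split=> [cD|[s sD ->]]; last first.
  by rewrite big_seq; apply: rpred_sum => xm /(allP sD); exact: pure_degen.
exists [seq (x, c@_x) | x <- enum_fset (msupp c)]; first by rewrite all_map.
by rewrite big_map [LHS]monalgE; apply: eq_bigr => x _; rewrite pure.unlock.
Qed.

Lemma face_sum_degen n k (p q : 'I_n.+1) (x : {ffun 'I_n.+1 -> X}) m :
  q = p.+1 :> nat -> x p = x q -> face_sum k (pure x m) \in @degen n.
Proof.
move=> qE xpq; have qp : q != p by rewrite -val_eqE /= qE neq_ltn ltnSn orbT.
rewrite /face_sum (bigD1 p) //= (bigD1 q) //= addrA.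
rewrite (face_pure k p) (face_pure k q) -xpq (face_seq_eq k qE xpq).
have -> : (-1) ^+ (n - p) = - (-1) ^+ (n - q) :> R.
  have lt_pn : (p < n)%N by rewrite -ltnS -qE ltn_ord.
  by rewrite qE -(subnSK lt_pn) exprS mulN1r.
rewrite scaleNr addNr add0r; apply: rpred_sum => i /andP[ip iq].
by apply: rpredZ; rewrite face_pure; apply: pure_degen; exact: face_seq_deg xpq ip iq.
Qed.

Fact bdry_degen n c : c \in @degen n.+1 -> bdry c \in @degen n.
Proof.
case/degen_span=> s sD ->; rewrite (linear_sum (@bdry n)) big_seq.
apply: rpred_sum => -[x m] /(allP sD) /= /existsP[p /existsP[q]].
case/andP=> /eqP qE /eqP xpq; apply: rpred_sum => k _; apply: rpredZ.
exact: face_sum_degen qE xpq.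
Qed.

Definition degenerate_subcomplex : subcomplex chain_complex :=
  @Subcomplex R chain_complex (fun n => @degen n.+1) (fun n => @bdry_degen n.+1).

Definition complexD := sub_complex degenerate_subcomplex.
Definition complexN := quot_complex degenerate_subcomplex.

End ChainComplex.

Section InducedChainMap.
Variables (r : nat) (R : comPzRingType) (a : 'I_r -> R).
Variables (X X' : multispindle r) (phi : ms_hom X X') (M : xmodule R X').

Local Notation Mphi := (pullback phi M).

Definition map_seq n (x : {ffun 'I_n -> X}) : {ffun 'I_n -> X'} :=
  [ffun i => phi (x i)].

Definition push n : chains Mphi n -> chains M n :=
  tensor_ext (fun x => pure (map_seq x) : {linear Mphi -> chains M n}).

Fact push_linear n : linear (@push n).
Proof. by move=> b c d; rewrite /push linearP. Qed.

HB.instance Definition _ n :=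
  GRing.isLinear.Build R (chains Mphi n) (chains M n) *:%R (@push n)
    (@push_linear n).

Lemma push_pure n x (m : M) : @push n (pure x (m : Mphi)) = pure (map_seq x) m.
Proof. by rewrite /push tensor_ext_pure. Qed.

Lemma push0 n : @push n 0 = 0.
Proof. exact: linear0. Qed.

Lemma pushD n c d : @push n (c + d) = push c + push d.
Proof. exact: linearD. Qed.

Lemma pushZ n b c : @push n (b *: c) = b *: push c.
Proof. exact: linearZ. Qed.

Lemma push_sum n I (s : seq I) (F : I -> chains Mphi n) :
  push (\sum_(i <- s) F i) = \sum_(i <- s) push (F i).
Proof. exact: linear_sum. Qed.

Lemma push_face n k (i : 'I_n.+1) (c : chains Mphi n.+1) :
  push (face k i c) = face k i (push c).
Proof.
elim/tensor_ind: c => [|x m c IHc]; first by rewrite face0 !push0 face0.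
rewrite faceD !pushD faceD IHc.
congr (_ + _); rewrite face_pure push_pure push_pure face_pure /= ffunE.
congr pure; apply/ffunP => j; rewrite !ffunE.
by case: ifP => // _; rewrite ms_funE.
Qed.

Lemma push_bdry n (c : chains Mphi n.+1) :
  push (bdry a c) = bdry a (push c).
Proof.
rewrite {1}/bdry push_sum; apply: eq_bigr => k _.
rewrite pushZ; congr (_ *: _).
rewrite {1}/face_sum push_sum; apply: eq_bigr => i _.
by rewrite pushZ push_face.
Qed.

Definition induced_map : chain_map (chain_complex a Mphi) (chain_complex a M) :=
  @ChainMap R (chain_complex a Mphi) (chain_complex a M)
    (fun n => @push n.+1) (fun n => @push_bdry n.+1).

Lemma push_degen n c : c \in @degen r R X Mphi n -> push c \in @degen r R X' M n.
Proof.
case/degen_span=> s sD ->; rewrite push_sum big_seq.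
apply: rpred_sum => -[x m] /(allP sD) /= /existsP[p /existsP[q]].
case/andP=> /eqP qE /eqP xpq; rewrite push_pure; apply: pure_degen.
by apply/existsP; exists p; apply/existsP; exists q; rewrite !ffunE xpq qE !eqxx.
Qed.

(* φ_* on H^D_n and H^N_n. *)
Definition HD_map n :
    {linear homology (complexD a Mphi) n -> homology (complexD a M) n} :=
  homology_map
    (@sub_chain_map R _ _ (degenerate_subcomplex a Mphi)
       (degenerate_subcomplex a M) induced_map (fun n => @push_degen n.+1)) n.

Definition HN_map n :
    {linear homology (complexN a Mphi) n -> homology (complexN a M) n} :=
  homology_map
    (@quot_chain_map R _ _ (degenerate_subcomplex a Mphi)
       (degenerate_subcomplex a M) induced_map (fun n => @push_degen n.+1)) n.

End InducedChainMap.

(* Main.v *)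
(* Lists of elements of X, with x_0 as head, index the direct sum C of M and of
   all C_n(M;X), with boundary d(x :: s) = x :: d s + (-1)^|s| s.x.  Hence s.x
   is a boundary when s is a cycle: the homology of C is a family of X-modules
   with vanishing compound action.

   Filter the degenerate chains by the position of the first repetition
   x_p = x_{p+1}.  A chain (u, x_p, x_p, ..., x_0) of the graded piece is a
   nondegenerate sequence (x_p, ..., x_0) with coefficient u in C; modulo lower
   filtration its boundary only involves d u, and the next component of the
   boundary is, in the homology of C, the normalized boundary of (x_p, ..., x_0)
   with coefficient the class of u.  So E^2 is the normalized homology with
   coefficients in the homology of C.

   Only lengths of u below n matter for degenerate chains of length n.  By
   induction on n these have isomorphic homology over X and X', which makes E^2
   of the mapping cone of phi vanish by the hypothesis on modules with vanishing
   compound action.  For this the cone pairs filtration p of the source with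
   filtration p + 1 of the target, so that phi counts as part of the horizontal
   boundary.  Then the normalized and the degenerate part give all of C. *)

Require Import Defs.
From HB Require Import structures.
From mathcomp Require Import all_boot all_algebra finmap.
From mathcomp Require Import monalg.
From mathcomp Require Import boolp zify.

Set Implicit Arguments.
Unset Strict Implicit.
Unset Printing Implicit Defensive.

Import GRing.Theory.
Local Open Scope ring_scope.

(** * Chains with coefficients *)

Definition linear_of (R : pzRingType) (U V : lmodType R) (f : U -> V)
  (f_linear : linear f) : {linear U -> V} :=
  HB.pack f (GRing.isLinear.Build R U V *:%R f f_linear).

Lemma bij_inj_surj (A B : choiceType) (f : A -> B) :
  bijective f <-> injective f /\ (forall b, exists a, f a = b).
Proof.
split=> [fb | [fi fs]].
  by split=> [|b]; [exact: bij_inj | case: fb => g _ fK; exists (g b)].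
have fs' b : exists a, f a == b by have [a <-] := fs b; exists a.
exists (fun b => xchoose (fs' b)) => [a|b]; last exact/eqP/(xchooseP (fs' b)).
exact/fi/eqP/(xchooseP (fs' (f a))).
Qed.

Section TensorSupport.
Variables (R : pzRingType) (M : lmodType R) (K : choiceType).
Implicit Types (k : K) (P Q : pred K) (c : tensor_free M K).

Lemma coeff_pure k (m : M) k' : (pure k m)@_k' = if k == k' then m else 0.
Proof. by rewrite pure.unlock mcoeffU mulrb. Qed.

Lemma coeffD c c' k : (c + c')@_k = c@_k + c'@_k.
Proof. exact: mcoeffD. Qed.

Lemma coeff0 k : (0 : tensor_free M K)@_k = 0.
Proof. exact: mcoeff0. Qed.

Lemma tensor_sum c : c = \sum_(k <- msupp c) pure k c@_k.
Proof. by rewrite [LHS]monalgE; apply: eq_bigr => k _; rewrite pure.unlock. Qed.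

Definition supported P : {pred tensor_free M K} :=
  fun c => all P (enum_fset (msupp c)).

Lemma supportedP P c :
  reflect (forall k, ~~ P k -> c@_k = 0) (c \in supported P).
Proof.
rewrite unfold_in; apply: (iffP allP) => [cP k kP|cP k].
  by apply: mcoeff_outdom; apply: contra kP; exact: cP.
by rewrite -mcoeff_neq0; apply: contraR => /cP->.
Qed.

Fact supported_closed P : submod_closed (supported P).
Proof.
split=> [|b c d /supportedP cP /supportedP dP]; apply/supportedP => k kP.
  exact: coeff0.
by rewrite coeffD tcoeffZ cP // dP // scaler0 addr0.
Qed.

HB.instance Definition _ P :=
  GRing.isSubmodClosed.Build R (tensor_free M K) (supported P)
    (supported_closed P).

Lemma supported_pure P k (m : M) : P k -> pure k m \in supported P.
Proof.
by move=> kP; apply/supportedP => k' /negP k'P; rewrite coeff_pure;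
  case: eqP => // kk'; case: k'P; rewrite -kk'.
Qed.

Lemma supported_sub P Q c : (forall k, P k -> Q k) ->
  c \in supported P -> c \in supported Q.
Proof.
move=> PQ /supportedP cP; apply/supportedP => k kQ; apply: cP.
by apply: contra kQ; exact: PQ.
Qed.

Lemma supportedI P Q c :
  c \in supported P -> c \in supported Q -> c \in supported (predI P Q).
Proof.
move=> /supportedP cP /supportedP cQ; apply/supportedP => k.
by rewrite negb_and => /orP[/cP|/cQ].
Qed.

Lemma supported0 P c :
  (forall k, ~~ P k) -> c \in supported P -> c = 0.
Proof.
by move=> P0 /supportedP cP; apply/malgP => k; rewrite cP // coeff0.
Qed.

(** For a submodule [W] these are the chains of W ⊗ R<K>; arbitrary predicates are allowed so that
    [predT] can express the absence of a restriction. *)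
Definition coeffs_in (W : {pred M}) : {pred tensor_free M K} :=
  fun c => all (fun k => c@_k \in W) (enum_fset (msupp c)).

Lemma coeffs_inP (W : submodClosed M) c :
  reflect (forall k, c@_k \in W) (c \in coeffs_in W).
Proof.
rewrite unfold_in; apply: (iffP allP) => [cW k|cW k _]; last exact: cW.
case: (boolP (k \in msupp c)) => [/cW //|kc].
by rewrite mcoeff_outdom ?rpred0.
Qed.

Fact coeffs_in_closed (W : submodClosed M) : submod_closed (coeffs_in W).
Proof.
split=> [|b c d /coeffs_inP cW /coeffs_inP dW]; apply/coeffs_inP => k.
  by rewrite coeff0 rpred0.
by rewrite coeffD tcoeffZ rpredD // rpredZ.
Qed.

HB.instance Definition _ (W : submodClosed M) :=
  GRing.isSubmodClosed.Build R (tensor_free M K) (coeffs_in W)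
    (coeffs_in_closed W).

Lemma coeffs_in_pure (W : submodClosed M) k m :
  m \in W -> pure k m \in coeffs_in W.
Proof.
by move=> mW; apply/coeffs_inP => k'; rewrite coeff_pure; case: ifP;
  rewrite ?rpred0.
Qed.

Lemma coeffs_inT c : c \in coeffs_in predT.
Proof. by rewrite unfold_in; apply/allP. Qed.

Lemma supportedT c : c \in supported predT.
Proof. by rewrite unfold_in; apply/allP. Qed.

Variable V : lmodType R.

Lemma linear_tensor (f : {linear tensor_free M K -> V}) c :
  f c = \sum_(k <- msupp c) f (pure k c@_k).
Proof. by rewrite {1}[c]tensor_sum linear_sum. Qed.

(** Both values are sums over the support of [c] of values on pure tensors. Most identities of
    chains below are reduced to generators this way. *)
Lemma tensor_eq P (W : {pred M}) (f g : {linear tensor_free M K -> V}) :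
  (forall k m, P k -> m \in W -> f (pure k m) = g (pure k m)) ->
  forall c, c \in supported P -> c \in coeffs_in W -> f c = g c.
Proof.
move=> fg c /allP cP /allP cW; rewrite linear_tensor [RHS]linear_tensor.
by apply: eq_big_seq => k kc; apply: fg; [exact: cP | exact: cW].
Qed.

Lemma tensor_in P (W : {pred M}) (f : {linear tensor_free M K -> V})
    (S : submodClosed V) :
  (forall k m, P k -> m \in W -> f (pure k m) \in S) ->
  forall c, c \in supported P -> c \in coeffs_in W -> f c \in S.
Proof.
move=> fS c /allP cP /allP cW; rewrite linear_tensor big_seq.
by apply: rpred_sum => k kc; apply: fS; [exact: cP | exact: cW].
Qed.

Lemma tensor_eqT (f g : {linear tensor_free M K -> V}) :
  (forall k m, f (pure k m) = g (pure k m)) -> forall c, f c = g c.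
Proof.
by move=> fg c; apply: (@tensor_eq predT predT) => //;
  rewrite ?coeffs_inT ?supportedT.
Qed.

Lemma tensor_inT P (f : {linear tensor_free M K -> V}) (S : submodClosed V) :
  (forall k m, P k -> f (pure k m) \in S) ->
  forall c, c \in supported P -> f c \in S.
Proof.
move=> fS c cP; apply: (@tensor_in P predT) => // [k m kP _|]; first exact: fS.
exact: coeffs_inT.
Qed.

Definition text (g : K -> {linear M -> V}) : {linear tensor_free M K -> V} :=
  tensor_ext g.

Lemma textE g k m : text g (pure k m) = g k m.
Proof. exact: tensor_ext_pure. Qed.

End TensorSupport.
#[global] Opaque text.

(** * Change of coefficients *)

Section TensorMap.
Variables (R : pzRingType) (M N : lmodType R) (K : choiceType).
Variable f : {linear M -> N}.

Definition tmap : {linear tensor_free M K -> tensor_free N K} :=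
  text (fun k => pure k \o f).

Lemma tmap_pure k m : tmap (pure k m) = pure k (f m).
Proof. exact: textE. Qed.

Lemma coeff_tmap c k : (tmap c)@_k = f c@_k.
Proof.
elim/tensor_ind: c => [|k' m c IHc]; first by rewrite linear0 !coeff0 linear0.
rewrite linearD tmap_pure !coeffD IHc !coeff_pure linearD.
by case: eqP => _ //; rewrite linear0.
Qed.

Lemma supported_tmap P c : c \in supported P -> tmap c \in supported P.
Proof.
by move=> /supportedP cP; apply/supportedP => k /cP c0;
  rewrite coeff_tmap c0 linear0.
Qed.

Definition all_in : {pred M} := predT.

Fact all_in_closed : submod_closed all_in.
Proof. by []. Qed.

HB.instance Definition _ := GRing.isSubmodClosed.Build R M all_in all_in_closed.

(** Preimages are chosen only for the finitely many coefficients on the support, which keeps the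
    lift supported in [P]. *)
Lemma tmap_lift P (W : submodClosed M) c : c \in supported P ->
  (forall k, exists2 m, m \in W & f m = c@_k) ->
  exists c', [/\ c' \in supported P, c' \in coeffs_in W & tmap c' = c].
Proof.
move=> /allP cP cf.
have lift_sum (s : seq K) : {in s, forall k, P k} -> exists c',
    [/\ c' \in supported P, c' \in coeffs_in W
      & tmap c' = \sum_(k <- s) pure k c@_k].
  elim: s => [|k s IHs] sP; first by exists 0; rewrite !rpred0 linear0 big_nil.
  have [|c' [c'P c'W c'E]] := IHs.
    by move=> k' k's; apply: sP; rewrite inE k's orbT.
  have [m mW fm] := cf k; exists (pure k m + c'); split.
  - by rewrite rpredD // supported_pure // sP // mem_head.
  - by rewrite rpredD // coeffs_in_pure.
  - by rewrite linearD tmap_pure fm big_cons c'E.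
have [c' [c'P c'W c'E]] := lift_sum _ cP.
by exists c'; rewrite c'E -tensor_sum.
Qed.

Lemma tmap_surj P c : c \in supported P ->
  (forall k, exists m, f m = c@_k) ->
  exists2 c', c' \in supported P & tmap c' = c.
Proof.
move=> cP cf; have [|c' [c'P _ c'E]] := tmap_lift (W := all_in) cP;
  last by exists c'.
by move=> k; have [m mE] := cf k; exists m.
Qed.

End TensorMap.
#[global] Opaque tmap.
Arguments tmap {R M N K} f.

Lemma tmap_comp (R : pzRingType) (M N P : lmodType R) (K : choiceType)
    (g : {linear N -> P}) (f : {linear M -> N}) (c : tensor_free M K) :
  tmap g (tmap f c) = tmap (g \o f) c.
Proof. by apply/malgP => k; rewrite !coeff_tmap. Qed.

Lemma eq_tmap (R : pzRingType) (M N : lmodType R) (K : choiceType)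
    (f g : {linear M -> N}) (c : tensor_free M K) :
  f =1 g -> tmap f c = tmap g c.
Proof. by move=> fg; apply/malgP => k; rewrite !coeff_tmap fg. Qed.

(** * Chains on lists *)

Section CompoundAction.
Variables (r : nat) (R : comPzRingType) (a : 'I_r -> R) (X : multispindle r).
Variable M : xmodule R X.

Fact compound_linear x : linear (fun m : M => compound a m x).
Proof.
move=> b m n; rewrite /compound scaler_sumr -big_split;
  apply: eq_bigr => k _ /=.
by rewrite linearP scalerDr !scalerA [b * _]mulrC.
Qed.

Definition cact x : {linear M -> M} := linear_of (compound_linear x).

Lemma cactE x m : cact x m = \sum_(k < r) a k *: xact k x m.
Proof. by []. Qed.

Lemma xact_cact k x y m :
  xact k y (cact x m) = cact (ms_op k x y) (xact k y m).
Proof.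
rewrite !cactE linear_sum; apply: eq_bigr => i _.
by rewrite linearZ; congr (_ *: _); exact: xactE.
Qed.

End CompoundAction.
#[global] Opaque cact.

(** * The boundary on lists and the module structure on chains *)

Section SeqChains.
Variables (r : nat) (R : comPzRingType) (a : 'I_r -> R) (X : multispindle r).
Variable M : xmodule R X.

(* The direct sum of M and of all C_n(M;X); the head of a list is x_0. *)
Definition seq_chains : lmodType R := tensor_free M (seq X).

Local Notation T := seq_chains.
Implicit Types (c : T) (x y : X) (s : seq X) (n : nat).

Definition of_size n : pred (seq X) := fun s => size s == n.

Definition hcons x : {linear T -> T} := text (fun s => pure (x :: s)).

Lemma hcons_pure x s (m : M) : hcons x (pure s m) = pure (x :: s) m.
Proof. exact: textE. Qed.
Opaque hcons.

Definition act_seq k y s : seq X := [seq ms_op k x y | x <- s].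

Definition lact k y : {linear T -> T} :=
  text (fun s => pure (act_seq k y s) \o xact k y).

Lemma lact_pure k y s (m : M) :
  lact k y (pure s m) = pure (act_seq k y s) (xact k y m).
Proof. exact: textE. Qed.
Opaque lact.

Lemma lact_distr i j x y c :
  lact j y (lact i x c) = lact i (ms_op j x y) (lact j y c).
Proof.
move: c; apply: (tensor_eqT (f := lact j y \o lact i x)
  (g := lact i (ms_op j x y) \o lact j y)) => s m /=.
rewrite !lact_pure xactE; congr pure.
by rewrite /act_seq -!map_comp; apply: eq_map => z /=; rewrite ms_distr.
Qed.

(** With the simultaneous action on entries and coefficient, chains can serve as coefficients: in
    [seq_chains (seqmod M)] the list carries x_p, ..., x_0 and the coefficient carries the part [u]
    of a degenerate sequence. *)
Definition seqmod : xmodule R X := XModule lact_distr.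

Definition lcact x : {linear T -> T} := cact a seqmod x.

Lemma lcactE x c : lcact x c = \sum_(k < r) a k *: lact k x c.
Proof. exact: (@cactE r R a X seqmod). Qed.
Opaque lcact.

Lemma lact_lcact k x y c :
  lact k y (lcact x c) = lcact (ms_op k x y) (lact k y c).
Proof. exact: (@xact_cact r R a X seqmod). Qed.

(** The recursion separates d_0, which acts on all that remains, from the faces that keep x_0;
    deleting x_0 from n + 1 entries has sign (-1)^n. On one entry the boundary is the compound
    action, with values in M. *)
Fixpoint bd s : M -> T :=
  if s is x :: s' then
    fun m => hcons x (bd s' m) + (-1) ^+ size s' *: lcact x (pure s' m)
  else fun=> 0.

Fact bd_linear s : linear (bd s).
Proof.
elim: s => [|x s IHs] b m n /=; first by rewrite scaler0 addr0.
by rewrite IHs !linearP scalerDr !scalerA [b * _]mulrC addrACA.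
Qed.

Definition dseq : {linear T -> T} := text (fun s => linear_of (bd_linear s)).

Local Notation d := dseq.

Lemma d_pure s (m : M) : d (pure s m) = bd s m.
Proof. exact: textE. Qed.
Opaque dseq.

Lemma d_nil (m : M) : d (pure [::] m) = 0.
Proof. by rewrite d_pure. Qed.

(** Up to sign, prepending [x] is a homotopy from the compound action of [x] to 0. *)
Lemma d_hcons n x c : c \in supported (of_size n) ->
  d (hcons x c) = hcons x (d c) + (-1) ^+ n *: lcact x c.
Proof.
move=> cn; pose e : R := (-1) ^+ n.
have gl : linear (fun c => hcons x (d c) + e *: lcact x c).
  move=> b c1 c2; rewrite !linearP.
  by rewrite scalerDr !scalerA [b * _]mulrC addrACA.
apply: (tensor_eq (f := d \o hcons x) (g := linear_of gl) _ cn (coeffs_inT c)).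
by move=> s m /eqP sn _ /=; rewrite hcons_pure !d_pure /= sn.
Qed.

Lemma supported_hcons (P Q : pred (seq X)) x c : (forall s, P s -> Q (x :: s))
  ->
  c \in supported P -> hcons x c \in supported Q.
Proof.
move=> PQ; apply: tensor_inT => s m Ps.
by rewrite hcons_pure supported_pure ?PQ.
Qed.

Lemma supported_lact (P Q : pred (seq X)) k y c :
  (forall s, P s -> Q (act_seq k y s)) ->
  c \in supported P -> lact k y c \in supported Q.
Proof.
move=> PQ; apply: tensor_inT => s m Ps.
by rewrite lact_pure supported_pure ?PQ.
Qed.

Lemma supported_lcact (P Q : pred (seq X)) y c :
  (forall k s, P s -> Q (act_seq k y s)) ->
  c \in supported P -> lcact y c \in supported Q.
Proof.
move=> PQ cP; rewrite lcactE rpred_sum // => k _; rewrite rpredZ //.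
by apply: supported_lact cP; exact: PQ.
Qed.

Lemma size_hcons n x c : c \in supported (of_size n) ->
  hcons x c \in supported (of_size n.+1).
Proof. exact: supported_hcons. Qed.

Lemma size_lact n k y c : c \in supported (of_size n) ->
  lact k y c \in supported (of_size n).
Proof. by apply: supported_lact => s; rewrite /of_size size_map. Qed.

Lemma size_lcact n y c : c \in supported (of_size n) ->
  lcact y c \in supported (of_size n).
Proof. by apply: supported_lcact => k s; rewrite /of_size size_map. Qed.

(** On the empty list the truncated predecessor is harmless, since the boundary is 0. *)
Lemma size_bd s (m : M) : bd s m \in supported (of_size (size s).-1).
Proof.
elim: s => [|x s IHs] /=; first exact: rpred0.
apply: rpredD; last first.
  by rewrite rpredZ // size_lcact // supported_pure // /of_size eqxx.
by case: s IHs => [|y s] IHs /=; [rewrite linear0 rpred0 | rewrite size_hcons].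
Qed.

Lemma size_d n c : c \in supported (of_size n.+1) ->
  d c \in supported (of_size n).
Proof.
apply: tensor_inT => s m /eqP sn; rewrite d_pure.
by have := size_bd s m; rewrite sn.
Qed.

Lemma lact_hcons k x y c :
  lact k y (hcons x c) = hcons (ms_op k x y) (lact k y c).
Proof.
move: c; apply: (tensor_eqT (f := lact k y \o hcons x)
  (g := hcons (ms_op k x y) \o lact k y)) => s m /=.
by rewrite !(hcons_pure, lact_pure).
Qed.

(** The actions are chain maps, so they descend to homology. In the inductive step d_0 is handled by
    [lact_lcact], the module axiom summed with the weights. *)
Lemma d_lact k y c : d (lact k y c) = lact k y (d c).
Proof.
move: c; apply: (tensor_eqT (f := d \o lact k y) (g := lact k y \o d)) => s m
  /=.
rewrite lact_pure !d_pure; elim: s m => [|x s IHs] m /=;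
  first by rewrite linear0.
by rewrite linearD linearZ lact_hcons lact_lcact lact_pure IHs size_map.
Qed.

Lemma d_lcact y c : d (lcact y c) = lcact y (d c).
Proof.
rewrite !lcactE linear_sum; apply: eq_bigr => k _.
by rewrite linearZ d_lact.
Qed.

Lemma ddK c : d (d c) = 0.
Proof.
move: c; apply: (tensor_eqT (f := d \o d) (g := \0)) => s m /=; rewrite d_pure.
elim: s => [|x s IHs] /=; first by rewrite linear0.
have /= sizeE := size_bd s m; rewrite linearD linearZ d_lcact d_pure.
rewrite (d_hcons x sizeE) IHs linear0 add0r -scalerDl.
(* The two mixed terms have the signs (-1)^(|s|-1) and (-1)^|s| and cancel; for empty [s] both are
   0. *)
by case: s {IHs sizeE} => [|y s] /=;
  rewrite ?linear0 ?scaler0 // exprS mulN1r subrr scale0r.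
Qed.

End SeqChains.
#[global] Opaque hcons lact lcact dseq.
Arguments hcons {r R X M} x.
Arguments lact {r R X M} k y.
Arguments lcact {r R} a {X M} x.
Arguments dseq {r R} a {X M}.

(** * Naturality in the coefficient module *)

Section ModuleMaps.
Variables (r : nat) (R : comPzRingType) (a : 'I_r -> R) (X : multispindle r).
Variables (M N : xmodule R X) (f : {linear M -> N}).
Hypothesis f_act : forall k x m, f (xact k x m) = xact k x (f m).

Local Notation fT := (tmap (K := seq X) f).

Lemma tmap_hcons x c : fT (hcons x c) = hcons x (fT c).
Proof.
move: c; apply: (tensor_eqT (f := fT \o hcons x) (g := hcons x \o fT)) => s m
  /=.
by rewrite !(hcons_pure, tmap_pure).
Qed.

Lemma tmap_lact k x c : fT (lact k x c) = lact k x (fT c).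
Proof.
move: c; apply: (tensor_eqT (f := fT \o lact k x) (g := lact k x \o fT)) => s m
  /=.
by rewrite !(lact_pure, tmap_pure) f_act.
Qed.

Lemma tmap_lcact x c : fT (lcact a x c) = lcact a x (fT c).
Proof.
rewrite !lcactE linear_sum; apply: eq_bigr => k _.
by rewrite linearZ tmap_lact.
Qed.

Lemma tmap_d c : fT (dseq a c) = dseq a (fT c).
Proof.
move: c; apply: (tensor_eqT (f := fT \o dseq a) (g := dseq a \o fT)) => s m /=.
rewrite tmap_pure !d_pure; elim: s => [|x s IHs] /=; first exact: linear0.
by rewrite linearD linearZ tmap_hcons tmap_lcact tmap_pure IHs.
Qed.

End ModuleMaps.

(** * Naturality in the multispindle *)

Section Pushforward.
Variables (r : nat) (R : comPzRingType) (a : 'I_r -> R) (X X' : multispindle r).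
Variables (phi : ms_hom X X') (M : xmodule R X').

Local Notation Mphi := (pullback phi M).

Definition lpush : {linear seq_chains Mphi -> seq_chains M} :=
  text (fun s => pure (map phi s) : {linear Mphi -> seq_chains M}).

Lemma lpush_pure s (m : M) : lpush (pure s (m : Mphi)) = pure (map phi s) m.
Proof. exact: textE. Qed.
Opaque lpush.

Lemma lpush_hcons x c : lpush (hcons x c) = hcons (phi x) (lpush c).
Proof.
move: c; apply: (tensor_eqT (f := lpush \o hcons x) (g := hcons (phi x) \o
  lpush)).
by move=> s m /=; rewrite !(hcons_pure, lpush_pure).
Qed.

Lemma lpush_lact k x c : lpush (lact k x c) = lact k (phi x) (lpush c).
Proof.
move: c; apply: (tensor_eqT (f := lpush \o lact k x) (g := lact k (phi x) \o
  lpush)).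
move=> s m /=; rewrite !(lact_pure, lpush_pure); congr pure.
by rewrite /act_seq -!map_comp; apply: eq_map => y /=; rewrite ms_funE.
Qed.

Lemma lpush_lcact x c : lpush (lcact a x c) = lcact a (phi x) (lpush c).
Proof.
rewrite !lcactE linear_sum; apply: eq_bigr => k _.
by rewrite linearZ lpush_lact.
Qed.

Lemma lpush_d c : lpush (dseq a c) = dseq a (lpush c).
Proof.
move: c; apply: (tensor_eqT (f := lpush \o dseq a) (g := dseq a \o lpush)) => s
  m /=.
rewrite lpush_pure !d_pure; elim: s => [|x s IHs] /=; first exact: linear0.
by rewrite linearD linearZ lpush_hcons lpush_lcact lpush_pure IHs size_map.
Qed.

Lemma supported_lpush (P : pred (seq X)) (Q : pred (seq X')) c :
  (forall s, P s -> Q (map phi s)) ->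
  c \in supported P -> lpush c \in supported Q.
Proof.
move=> PQ; apply: tensor_inT => s m Ps.
by rewrite lpush_pure supported_pure ?PQ.
Qed.

Lemma size_lpush n c : c \in supported (of_size n) ->
  lpush c \in supported (of_size n).
Proof. by apply: supported_lpush => s; rewrite /of_size size_map. Qed.

End Pushforward.
#[global] Opaque lpush.
Arguments lpush {r R X X' phi M}.

Section PushforwardNaturality.
Variables (r : nat) (R : comPzRingType) (X X' : multispindle r).
Variables (phi : ms_hom X X') (M N : xmodule R X') (f : {linear M -> N}).

Lemma lpush_tmap c :
  lpush (phi := phi) (M := N)
    (tmap (f : {linear pullback phi M -> pullback phi N}) c)
  = tmap f (lpush c).
Proof.
move: c; apply: (tensor_eqT
  (f := lpush \o tmap (f : {linear pullback phi M -> pullback phi N}))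
  (g := tmap f \o lpush)) => s m /=.
by rewrite tmap_pure (@lpush_pure _ _ _ _ phi M s m) tmap_pure (@lpush_pure _ _
  _ _ phi N s (f m)).
Qed.

End PushforwardNaturality.

(** * The filtration of the degenerate chains *)

Definition nondeg (X : eqType) : pred (seq X) := sorted (fun x y => x != y).

Definition deg (X : eqType) : pred (seq X) := predC (@nondeg X).

(* Some x_i = x_{i+1} with i + 1 < j. *)
Definition deg_take (X : eqType) j : pred (seq X) := fun s => deg (take j s).

Section NondegenerateSequences.
Variable X : eqType.
Implicit Types (x y : X) (s t u : seq X).

Lemma deg_take_leq i j s : (i <= j)%N -> deg_take i s -> deg_take j s.
Proof.
by move=> le_ij; apply: contra => /(take_sorted i); rewrite take_takel.
Qed.

Lemma deg_takeW j s : deg_take j s -> deg s.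
Proof. by apply: contra; apply: take_sorted. Qed.

Lemma deg_take_size j s : (size s <= j)%N -> deg_take j s = deg s.
Proof. by move=> le_sj; rewrite /deg_take take_oversize. Qed.

Lemma deg_take_cons j x s : deg_take j s -> deg_take j.+1 (x :: s).
Proof. by apply: contra => /path_sorted. Qed.

Lemma nondeg_map (Y : eqType) (f : X -> Y) s :
  nondeg (map f s) -> nondeg s.
Proof.
rewrite /nondeg sorted_map; apply: sub_sorted => x y /=.
by apply: contra => /eqP->.
Qed.

Lemma deg_map (Y : eqType) (f : X -> Y) s : deg s -> deg (map f s).
Proof. by apply: contra; exact: nondeg_map. Qed.

Lemma deg_take_map (Y : eqType) (f : X -> Y) j s :
  deg_take j s -> deg_take j (map f s).
Proof. by rewrite /deg_take -map_take; exact: deg_map. Qed.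

Lemma deg_take0 s : deg_take 0 s = false.
Proof. by rewrite /deg_take take0. Qed.

Lemma deg_take1 s : deg_take 1 s = false.
Proof. by case: s => [|x s]; rewrite /deg_take //= take0. Qed.

(** If one more entry makes a prefix degenerate, that entry repeats its predecessor. The head [y] is
    kept apart so that a predecessor [last y t] exists even for empty [t]. *)
Lemma first_repeat y s j : nondeg (y :: take j s) -> deg (y :: take j.+1 s) ->
  exists t u, [/\ size t = j, s = t ++ last y t :: u & take j s = t].
Proof.
elim: j y s => [|j IHj] y [|z s] //=; rewrite ?take0 /deg /nondeg /=.
- by move=> _; rewrite andbT negbK => /eqP ->; exists [::], s.
case/andP=> -> sj dj; have [t [u [tj -> tE]]] := IHj z s sj dj.
by exists (z :: t), u; split => /=; rewrite ?tj ?tE.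
Qed.

End NondegenerateSequences.

(** * Projection to the nondegenerate chains *)

Section NondegeneratePart.
Variables (r : nat) (R : comPzRingType) (X : multispindle r).
Variable M : xmodule R X.

(** The kernel is the module of degenerate chains, so congruences modulo C^D become equations
    between chains. *)
Definition nondeg_part : {linear seq_chains M -> seq_chains M} :=
  text (fun s => if nondeg s then pure s : {linear M -> seq_chains M} else \0).

Lemma coeff_nondeg_part c s :
  (nondeg_part c)@_s = if nondeg s then c@_s else 0.
Proof.
elim/tensor_ind: c => [|s' m c IHc]; first by rewrite linear0 !coeff0 if_same.
rewrite linearD !coeffD IHc textE !coeff_pure.
case: (eqVneq s' s) => [->|s's]; case: ifP => _ /=;
  by rewrite ?coeff0 ?coeff_pure ?eqxx ?add0r // ifN // add0r.
Qed.

Lemma nondeg_part_pure s (m : M) :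
  nondeg_part (pure s m) = if nondeg s then pure s m else 0.
Proof. by rewrite textE; case: ifP. Qed.

Lemma nondeg_part_id c : c \in supported (@nondeg X) -> nondeg_part c = c.
Proof.
move=> /supportedP cN; apply/malgP => s; rewrite coeff_nondeg_part.
by case: ifP => // /negbT /cN ->.
Qed.

Lemma nondeg_part_eq0 c : nondeg_part c = 0 <-> c \in supported (@deg X).
Proof.
split=> [c0|/supportedP cD].
  apply/supportedP => s; rewrite negbK => sN.
  by rewrite -[LHS](ifT _ 0 sN) -coeff_nondeg_part c0 coeff0.
apply/malgP => s; rewrite coeff_nondeg_part coeff0; case: ifP => // sN.
by rewrite cD //= negbK.
Qed.

Lemma nondeg_part_coeffs (W : submodClosed M) c :
  c \in coeffs_in W -> nondeg_part c \in coeffs_in W.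
Proof.
move=> /coeffs_inP cW; apply/coeffs_inP => s.
by rewrite coeff_nondeg_part; case: ifP; rewrite ?rpred0.
Qed.

End NondegeneratePart.
#[global] Opaque nondeg_part.
Arguments nondeg_part {r R X M}.

Lemma tmap_nondeg_part (r : nat) (R : comPzRingType) (X : multispindle r)
    (M N : xmodule R X) (f : {linear M -> N}) (c : seq_chains M) :
  tmap f (nondeg_part c) = nondeg_part (tmap f c : seq_chains N).
Proof.
apply/malgP => s; rewrite coeff_tmap !coeff_nondeg_part coeff_tmap.
by case: ifP => // _; rewrite linear0.
Qed.

(** * Duplication, leading terms and the graded pieces *)

Section Duplication.
Variables (r : nat) (R : comPzRingType) (a : 'I_r -> R) (X : multispindle r).
Variable M : xmodule R X.

Local Notation T := (seq_chains M).
Local Notation TT := (seq_chains (seqmod M)).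
Local Notation d := (dseq a).
Implicit Types (x y : X) (s t u : seq X) (c : T) (z : TT) (j n : nat).

Lemma lcact_hcons_idem x c : lcact a x (hcons x c) = hcons x (lcact a x c).
Proof.
rewrite !lcactE linear_sum; apply: eq_bigr => k _.
by rewrite linearZ lact_hcons ms_idem.
Qed.

(** The faces deleting the two equal entries agree by idempotence and have opposite signs. *)
Lemma d_hcons2 x n c : c \in supported (of_size n) ->
  d (hcons x (hcons x c)) = hcons x (hcons x (d c)).
Proof.
move=> cn; rewrite (d_hcons a x (size_hcons x cn)) (d_hcons a x cn).
rewrite lcact_hcons_idem linearD linearZ -addrA -scalerDl.
by rewrite exprS mulN1r subrr scale0r addr0.
Qed.

(** Each filtration step is a subcomplex. A repetition beyond the head survives by induction and
    under the actions; otherwise the first two entries agree and [d_hcons2] applies. *)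
Lemma d_deg_take j c :
  c \in supported (deg_take j) -> d c \in supported (deg_take j).
Proof.
apply: tensor_inT => s m; rewrite d_pure; elim: s j => [|x s IHs] [|j] //=.
have hcons_deg x' i e : e \in supported (deg_take i) ->
    hcons x' e \in supported (deg_take (X := X) i.+1).
  by apply: supported_hcons => s'; exact: deg_take_cons.
case: (boolP (deg_take j s)) => [sj _|/negPn sj xs].
  apply: rpredD; first by rewrite hcons_deg // IHs.
  rewrite rpredZ //; apply: (@supported_lcact _ _ _ _ _ (deg_take j)).
    by move=> k s' /(deg_take_map (ms_op k ^~ x)); exact: deg_take_leq.
  by rewrite supported_pure.
case: j s xs sj {IHs hcons_deg} => [|j] [|y s] //=;
  rewrite ?deg_take1 // => xs sj.
have <- : x = y.
  apply/eqP; apply: contraR xs => xy.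
  by rewrite /nondeg /= xy.
(* The unfolded boundary is recognised as that of a chain with doubled head. *)
have -> : hcons x (hcons x (bd a s m) + (-1) ^+ size s *: lcact a x (pure s m))
    + (-1) ^+ (size s).+1 *: lcact a x (pure (x :: s) m)
  = d (hcons x (hcons x (pure s m))) by rewrite !hcons_pure d_pure.
have sn : pure s m \in supported (of_size (size s)) by rewrite supported_pure
  /of_size ?eqxx.
rewrite (d_hcons2 x sn); apply: supported_hcons (supported_hcons _ (supportedT
  _)) => //.
  by move=> t; exact.
by move=> t _; rewrite /deg_take /deg /nondeg /= eqxx.
Qed.

Fixpoint dup1 y t : {linear T -> T} :=
  if t is z :: t' then hcons y \o dup1 z t' else hcons y \o hcons y.

Lemma dup1_pure y t u (m : M) :
  dup1 y t (pure u m) = pure (y :: t ++ last y t :: u) m.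
Proof. by elim: t y => [|z t IHt] y /=; rewrite ?IHt !hcons_pure. Qed.

(** Sends the list (x_p, ..., x_0) with coefficient [u] to (u, x_p, x_p, ..., x_0). The empty list
    has no entry to double and goes to 0. *)
Definition Dup : {linear TT -> T} :=
  text (fun s => if s is y :: t then dup1 y t : {linear seqmod M -> T} else \0).

Lemma Dup_nil c : Dup (pure [::] c) = 0.
Proof. exact: textE. Qed.

Lemma Dup_cons y t c : Dup (pure (y :: t) c) = dup1 y t c.
Proof. exact: textE. Qed.
Opaque Dup.

Lemma lact_dup1 k x y t c :
  lact k x (dup1 y t c) = dup1 (ms_op k y x) (act_seq k x t) (lact k x c).
Proof. by elim: t y => [|z t IHt] y /=; rewrite !lact_hcons ?IHt. Qed.

Lemma Dup_lact k x z : Dup (lact k x z) = lact k x (Dup z).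
Proof.
move: z; apply: (tensor_eqT (f := Dup \o lact k x) (g := lact k x \o Dup)).
move=> [|y t] c /=; rewrite lact_pure; first by rewrite !Dup_nil linear0.
by rewrite !Dup_cons lact_dup1.
Qed.

Lemma Dup_lcact x z : Dup (lcact a x z) = lcact a x (Dup z).
Proof.
rewrite !lcactE linear_sum; apply: eq_bigr => k _.
by rewrite linearZ Dup_lact.
Qed.

Lemma Dup_hcons y z : z \in supported (fun s => 0 < size s)%N ->
  Dup (hcons y z) = hcons y (Dup z).
Proof.
move=> z0.
apply: (tensor_eq (f := Dup \o hcons y) (g := hcons y \o Dup) _ z0 (coeffs_inT
  z)).
by move=> [|x t] c //= _ _; rewrite hcons_pure !Dup_cons.
Qed.

(* The face d_p of the leftmost entry of the sequence (x_p, ..., x_0). *)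
Definition top : {linear TT -> TT} :=
  text (fun s => if s is y :: t
    then pure (belast y t) \o lcact a (last y t) : {linear seqmod M -> TT}
    else \0).

Lemma top_nil c : top (pure [::] c) = 0.
Proof. exact: textE. Qed.

Lemma top_cons y t c :
  top (pure (y :: t) c) = pure (belast y t) (lcact a (last y t) c).
Proof. exact: textE. Qed.
Opaque top.

Fact low_linear : linear (fun z => dseq a z - top z).
Proof. by move=> b z1 z2; rewrite !linearP scalerDr addrACA. Qed.

(** The faces d_0, ..., d_{p-1}. In the boundary of a duplicated chain the two faces deleting a copy
    of x_p cancel, so these are the faces of the list that remain. *)
Definition low : {linear TT -> TT} := linear_of low_linear.

Lemma lowE z : low z = dseq a z - top z.
Proof. by []. Qed.
Opaque low.

Lemma low_nil c : low (pure [::] c) = 0.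
Proof. by rewrite lowE d_nil top_nil subr0. Qed.

Lemma low_cons1 y c : low (pure [:: y] c) = 0.
Proof.
rewrite lowE d_pure top_cons /= linear0 add0r scale1r.
rewrite !lcactE linear_sum -sumrB big1 // => k _.
by rewrite linearZ lact_pure subrr.
Qed.

Lemma low_cons2 x y t c :
  low (pure (x :: y :: t) c)
    = hcons x (low (pure (y :: t) c)) + (-1) ^+ (size t).+1 *: lcact a x (pure
      (y :: t) c : TT).
Proof.
rewrite !lowE !d_pure !top_cons [in bd _ (x :: _) _]/bd -/bd /=.
by rewrite linearB hcons_pure addrAC.
Qed.

Lemma size_low n z : z \in supported (of_size n.+2) ->
  low z \in supported (of_size n.+1).
Proof.
move=> zn; rewrite lowE rpredB // ?size_d //.
move: z zn; apply: tensor_inT => -[|y t] c //= /eqP[tn].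
by rewrite top_cons supported_pure // /of_size size_belast tn.
Qed.

Lemma low_size1 z : z \in supported (of_size 1) -> low z = 0.
Proof.
move=> z1; apply: (tensor_eq (f := low) (g := \0) _ z1 (coeffs_inT z)).
by move=> [|x [|y t]] c //= _ _; exact: low_cons1.
Qed.

(** The sign (-1)^(n+1) accounts for the additional entries on the left: the [n] entries of [c] and
    the second copy of x_p. *)
Lemma d_dup1 n y t c : c \in supported (of_size n) ->
  d (dup1 y t c)
    = dup1 y t (d c) + (-1) ^+ n.+1 *: Dup (low (pure (y :: t) c)).
Proof.
move=> cn; elim: t y => [|z t IHt] y /=.
  by rewrite (d_hcons2 y cn) low_cons1 linear0 scaler0 addr0.
have zt : dup1 z t c \in supported (of_size (size t + n).+2).
  elim: t {IHt} z => [|x t IHt] z /=; first by rewrite !size_hcons.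
  by rewrite addSn size_hcons.
rewrite (d_hcons a y zt) IHt linearD linearZ -addrA /=; congr (_ + _).
rewrite low_cons2 [in RHS]linearD [in RHS]linearZ Dup_lcact Dup_cons scalerDr
  scalerA -exprD.
congr (_ + _); last first.
  by congr (_ *: _); rewrite -signr_odd -[RHS]signr_odd; congr (_ ^+ _); lia.
(* [Dup_hcons] needs nonempty lists: [low] vanishes on singletons and otherwise shortens the list by
   one. *)
rewrite Dup_hcons //; case: t {zt IHt} => [|x t];
  first by rewrite low_cons1 rpred0.
apply: (@supported_sub _ _ _ (of_size (size t).+1)); first by move=> s /eqP->.
by rewrite size_low // supported_pure /of_size /=.
Qed.

Lemma d_Dup n z : z \in coeffs_in (supported (of_size n)) ->
  d (Dup z) = Dup (tmap d z) + (-1) ^+ n.+1 *: Dup (low z).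
Proof.
move=> zn; pose e : R := (-1) ^+ n.+1.
have gl : linear (fun z => Dup (tmap d z) + e *: Dup (low z)).
  move=> b z1 z2; rewrite (linearP low) !linearP.
  by rewrite scalerDr !scalerA [b * _]mulrC addrACA.
apply: (tensor_eq (f := d \o Dup) (g := linear_of gl) _ (supportedT z) zn).
move=> [|y t] c /= _ cn; rewrite tmap_pure.
  by rewrite !Dup_nil low_nil !linear0 addr0.
by rewrite !Dup_cons (d_dup1 y t cn).
Qed.

(** Doubling x_{j-1} puts its copy at position [j], so the repetition shows among the first [j.+1]
    entries. *)
Lemma deg_Dup j z : z \in supported (of_size j) ->
  Dup z \in supported (deg_take j.+1).
Proof.
apply: tensor_inT => -[|y t] c /eqP /= <-; first by rewrite Dup_nil rpred0.
rewrite Dup_cons; apply: tensor_inT (supportedT c) => u m _.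
rewrite dup1_pure supported_pure // /deg_take /deg /nondeg /=.
by rewrite take_cat ltnNge leqnSn /= subSnn /= take0 cat_path /= eqxx andbF.
Qed.

Lemma size_Dup j n z : z \in supported (of_size j) ->
  z \in coeffs_in (supported (of_size n)) ->
  Dup z \in supported (of_size (j + n).+1).
Proof.
apply: tensor_in => -[|y t] c /eqP /= <-; first by rewrite Dup_nil rpred0.
rewrite Dup_cons; apply: tensor_inT => u m /eqP un.
by rewrite dup1_pure supported_pure // /of_size /= size_cat /= un addnS.
Qed.

(* On sequences (u, x_{j-1}, x_{j-1}, ..., x_0) whose first repetition is the
   displayed one, the inverse of the duplication map; 0 on all others. *)
Definition lead j : {linear T -> TT} :=
  text (fun s => if nondeg (take j s) && deg_take j.+1 s
    then pure (take j s) \o pure (drop j.+1 s) : {linear M -> TT} else \0).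

Lemma lead_pure j s (m : M) :
  lead j (pure s m) = if nondeg (take j s) && deg_take j.+1 s
    then pure (take j s) (pure (drop j.+1 s) m : seqmod M) else 0.
Proof. by rewrite textE; case: ifP. Qed.
Opaque lead.

(** A degenerate list produces an earlier repetition, which [lead] kills; a nondegenerate one is
    recovered. *)
Lemma lead_Dup j z : z \in supported (of_size j.+1) ->
  lead j.+1 (Dup z) = nondeg_part z.
Proof.
move=> zj.
apply: (tensor_eq (f := lead j.+1 \o Dup) (g := nondeg_part) _ zj (coeffs_inT
  z)).
move=> [|y t] c //= /eqP[tj] _; rewrite Dup_cons.
move: c; apply: (tensor_eqT (f := lead j.+1 \o dup1 y t)
  (g := nondeg_part \o pure (y :: t))) => u m /=.
rewrite dup1_pure lead_pure nondeg_part_pure /= -tj take_size_cat //.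
rewrite -cat_rcons drop_size_cat ?size_rcons //.
rewrite [deg_take _ _](_ : _ = true) ?andbT //.
rewrite /deg_take /deg /nondeg /= take_size_cat ?size_rcons //.
by rewrite rcons_path eqxx andbF.
Qed.

Lemma lead_deg j c : c \in supported (deg_take j) -> lead j c = 0.
Proof.
move=> cj; apply: (tensor_eq (f := lead j) (g := \0) _ cj (coeffs_inT c)).
move=> s m sj _; rewrite lead_pure; case: ifP => // /andP[sN _].
by move: sj; rewrite /deg_take /deg /= sN.
Qed.

(** A generator either has an earlier repetition, with [lead] equal to 0, or by [first_repeat] is
    the duplication of its leading term. So [lead j] describes the graded piece. *)
Lemma sub_lead j c : c \in supported (deg_take j.+1) ->
  c - Dup (lead j c) \in supported (deg_take j).
Proof.
have gl : linear (fun c => c - Dup (lead j c)).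
  by move=> b c1 c2; rewrite !linearP scalerDr addrACA.
apply: (tensor_inT (f := linear_of gl)) => s m sj /=;
  rewrite lead_pure sj andbT.
case: ifP => [sN|/negbT sN]; last by rewrite linear0 subr0 supported_pure.
case: j s sN sj {gl} => [|j] [|y s] //= sN sj; first by rewrite deg_take1 in sj.
have [t [u [tj sE tE]]] := first_repeat sN sj.
rewrite Dup_cons dup1_pure tE sE -cat_rcons drop_size_cat ?size_rcons ?tj //.
by rewrite cat_rcons subrr rpred0.
Qed.

Lemma deg_lead0 j c : c \in supported (deg_take j.+1) -> lead j c = 0 ->
  c \in supported (deg_take j).
Proof. by move=> /sub_lead cj c0; move: cj; rewrite c0 linear0 subr0. Qed.

Lemma size_lead j c : lead j c \in supported (of_size j).
Proof.
apply: tensor_inT (supportedT c) => s m _; rewrite lead_pure.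
case: ifP => [/andP[sN sj]|]; rewrite ?rpred0 // supported_pure //.
(* A list shorter than [j] has equal prefixes of lengths [j] and [j.+1], so it fails the test in
   [lead]. *)
rewrite /of_size size_takel //; apply: contraLR sj;
  rewrite -ltnNge => /ltnW lt_sj.
by rewrite /deg_take /deg /= negbK take_oversize ?(leq_trans lt_sj) //
  -(take_oversize lt_sj).
Qed.

Lemma nondeg_lead j c : lead j c \in supported (@nondeg X).
Proof.
apply: tensor_inT (supportedT c) => s m _; rewrite lead_pure.
by case: ifP => [/andP[sN _]|]; rewrite ?rpred0 // supported_pure.
Qed.

Lemma lead_coeffs j n c : c \in supported (of_size n) ->
  lead j c \in coeffs_in (supported (of_size (n - j.+1)%N)).
Proof.
apply: tensor_inT => s m /eqP sn; rewrite lead_pure.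
case: ifP; rewrite ?rpred0 // => _; rewrite coeffs_in_pure //.
by rewrite supported_pure // /of_size size_drop sn.
Qed.

Lemma deg_of_size n c : c \in supported (of_size n) ->
  c \in supported (@deg X) -> c \in supported (deg_take n).
Proof.
move=> cn cD; apply: supported_sub (supportedI cn cD) => s /andP[/eqP sn].
by rewrite deg_take_size ?sn.
Qed.

Lemma deg_take1_eq0 c : c \in supported (deg_take 1) -> c = 0.
Proof. by apply: supported0 => s; rewrite deg_take1. Qed.

Lemma deg_size1_eq0 c : c \in supported (of_size 1) ->
  c \in supported (@deg X) -> c = 0.
Proof. by move=> c1 cD; apply/deg_take1_eq0/deg_of_size. Qed.

(** The differential of the graded piece acts on coefficients alone: the remainder of [sub_lead]
    stays in lower filtration, and duplicating [low] creates an earlier repetition. *)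
Lemma lead_d j n c : c \in supported (deg_take j.+1) ->
  c \in supported (of_size n) -> lead j (d c) = tmap d (lead j c).
Proof.
case: j => [/deg_take1_eq0 -> _|j cj cn]; first by rewrite !linear0.
have cE : c = Dup (lead j.+1 c) + (c - Dup (lead j.+1 c)) by rewrite addrC
  subrK.
rewrite [in LHS]cE (linearD d) (linearD (lead _)).
rewrite (lead_deg (d_deg_take (sub_lead cj))) addr0.
rewrite (d_Dup (lead_coeffs j.+1 cn)) (linearD (lead _)) linearZZ.
rewrite lead_Dup ?supported_tmap ?size_lead // nondeg_part_id ?supported_tmap
  ?nondeg_lead //.
rewrite [lead _ (Dup (low _))](_ : _ = 0) ?scaler0 ?addr0 //.
have zj := size_lead j.+1 c; case: j zj {cj cn cE} => [|j] zj.
  by rewrite low_size1 ?linear0.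
by apply: lead_deg; apply: deg_Dup; exact: size_low.
Qed.

End Duplication.
#[global] Opaque Dup top low lead.
Arguments Dup {r R X M}.
Arguments top {r R} a {X M}.
Arguments low {r R} a {X M}.
Arguments lead {r R X M} j.

(** * Homology as a module *)

Section SeqHomology.
Variables (r : nat) (R : comPzRingType) (a : 'I_r -> R) (X : multispindle r).
Variable M : xmodule R X.

Local Notation T := (seq_chains M).
Local Notation TT := (seq_chains (seqmod M)).
Local Notation d := (dseq a).
Implicit Types (c : T) (j l : nat).

Definition cyc l : {pred T} :=
  fun c => (c \in supported (of_size l)) && (d c == 0).

Lemma cycP l c :
  reflect (c \in supported (of_size l) /\ d c = 0) (c \in cyc l).
Proof. by apply: (iffP andP) => -[cl /eqP dc]; rewrite ?dc. Qed.

Fact cyc_closed l : submod_closed (cyc l).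
Proof.
split=> [|b u v /cycP[ul du] /cycP[vl dv]]; apply/cycP.
  by rewrite linear0 rpred0.
by split; [rewrite rpredD // rpredZ | rewrite linearP du dv scaler0 addr0].
Qed.

HB.instance Definition _ l :=
  GRing.isSubmodClosed.Build R T (cyc l) (cyc_closed l).

Definition bnd l : {pred T} :=
  fun c => `[< exists2 u, u \in supported (of_size l.+1) & d u = c >].

Lemma bndP l c :
  reflect (exists2 u, u \in supported (of_size l.+1) & d u = c) (c \in bnd l).
Proof. exact: asboolP. Qed.

Fact bnd_closed l : submod_closed (bnd l).
Proof.
split=> [|b u v /bndP[u' u'l <-] /bndP[v' v'l <-]]; apply/bndP.
  by exists 0; rewrite ?linear0 ?rpred0.
by exists (b *: u' + v'); rewrite ?linearP // rpredD // rpredZ.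
Qed.

HB.instance Definition _ l :=
  GRing.isSubmodClosed.Build R T (bnd l) (bnd_closed l).

Lemma lact_cyc l k x c : c \in cyc l -> lact k x c \in cyc l.
Proof. by case/cycP=> cl dc; apply/cycP;
  rewrite size_lact // d_lact dc linear0. Qed.

Lemma lact_bnd l k x c : c \in bnd l -> lact k x c \in bnd l.
Proof.
by case/bndP=> u ul <-; apply/bndP; exists (lact k x u);
  rewrite ?size_lact ?d_lact.
Qed.

(** The homotopy [d_hcons] on a cycle; the sign of the witness cancels the one occurring there. *)
Lemma lcact_bnd l x c : c \in cyc l -> lcact a x c \in bnd l.
Proof.
case/cycP=> cl dc; apply/bndP; exists ((-1) ^+ l *: hcons x c).
  by rewrite rpredZ // size_hcons.
by rewrite linearZZ (d_hcons a x cl) dc linear0 add0r scalerA -exprD addnn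
  -signr_odd odd_double scale1r.
Qed.

Definition cyc_act l k x : {linear submod (cyc l) -> submod (cyc l)} :=
  Defs.sub_map (W := cyc l) (W' := cyc l) (f := lact k x) (@lact_cyc l k x).

Fact cyc_act_distr l (i j : 'I_r) x y z :
  cyc_act l j y (cyc_act l i x z)
    = cyc_act l i (ms_op j x y) (cyc_act l j y z).
Proof. by apply: val_inj; rewrite /= lact_distr. Qed.

(** An intermediate coefficient module: from cycles one can pass both to chains, by [cyc_val], and
    to homology, by [hom_class]. *)
Definition cycmod l : xmodule R X := XModule (@cyc_act_distr l).

Definition cyc_val l : {linear cycmod l -> seqmod M} := (val : submod (cyc l)
  -> T).

Lemma cyc_val_act l k x (z : cycmod l) :
  cyc_val l (xact k x z) = xact k x (cyc_val l z).
Proof. by []. Qed.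

Lemma cyc_val_in l (z : cycmod l) : cyc_val l z \in cyc l.
Proof. exact: valP. Qed.

Lemma cyc_valP l c : c \in cyc l -> exists z, cyc_val l z = c.
Proof. by move=> cl; exists (Submod cl). Qed.

Definition cyc_bnd l : {pred submod (cyc l)} := fun z => val z \in bnd l.

Lemma cyc_bndE l z : (z \in @cyc_bnd l) = (val z \in bnd l).
Proof. by []. Qed.

Fact cyc_bnd_closed l : submod_closed (@cyc_bnd l).
Proof.
split=> [|b z1 z2 z1b z2b]; rewrite [_ \in _]cyc_bndE ?rpred0 //.
have -> : val (b *: z1 + z2) = b *: val z1 + val z2 by [].
by rewrite rpredD // rpredZ.
Qed.

HB.instance Definition _ l :=
  GRing.isSubmodClosed.Build R (submod (cyc l)) (@cyc_bnd l) (cyc_bnd_closed l).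

Lemma cyc_act_bnd l k x z : z \in @cyc_bnd l -> cyc_act l k x z \in @cyc_bnd l.
Proof. exact: lact_bnd. Qed.

Definition hom_act l k x : {linear quotmod (@cyc_bnd l) -> quotmod (@cyc_bnd
  l)} :=
  Defs.quot_map (W := @cyc_bnd l) (W' := @cyc_bnd l) (f := cyc_act l k x)
    (@cyc_act_bnd l k x).

Lemma hom_act_proj l k x z :
  hom_act l k x (qproj (@cyc_bnd l) z) = qproj (@cyc_bnd l) (cyc_act l k x z).
Proof. exact: quot_map_proj. Qed.

Fact hom_act_distr l (i j : 'I_r) x y q :
  hom_act l j y (hom_act l i x q)
    = hom_act l i (ms_op j x y) (hom_act l j y q).
Proof. by rewrite -[q]qreprK !hom_act_proj cyc_act_distr. Qed.

(** The length [l = 0] is included; there the homology is M modulo the span of all compound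
    actions. *)
Definition hommod l : xmodule R X := XModule (@hom_act_distr l).

Definition hom_class l : {linear cycmod l -> hommod l} := qproj (@cyc_bnd l).

Lemma hom_class_act l k x (z : cycmod l) :
  hom_class l (xact k x z) = xact k x (hom_class l z).
Proof. by rewrite [RHS]hom_act_proj. Qed.

Lemma hom_class_eq0 l (z : cycmod l) :
  hom_class l z = 0 <-> cyc_val l z \in bnd l.
Proof. exact: (qproj_eq0 (@cyc_bnd l)). Qed.

Lemma hom_class_surj l q : exists z, hom_class l z = q.
Proof. by exists (qrepr q); exact: qreprK. Qed.

Lemma hommod_vanishing l : vanishing_compound a (hommod l).
Proof.
move=> q x; have [z <-] := hom_class_surj q.
have -> : compound a (hom_class l z) x = hom_class l (cact a (cycmod l) x z).
  rewrite cactE linear_sum; apply: eq_bigr => k _.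
  by rewrite linearZ hom_class_act.
apply/hom_class_eq0.
have -> : cyc_val l (cact a (cycmod l) x z) = lcact a x (cyc_val l z).
  rewrite cactE linear_sum lcactE; apply: eq_bigr => k _.
  by rewrite linearZ.
exact/lcact_bnd/cyc_val_in.
Qed.

(** The inverse acts by the inverse maps on entries and coefficient; being inverse to a chain map it
    commutes with [d], so it descends to homology. *)
Lemma hommod_invertible l : is_quandle X -> has_invertible_action M ->
  has_invertible_action (hommod l).
Proof.
move=> Xq Mi k x; have [op opK Kop] := Xq k x; have [act actK Kact] := Mi k x.
have act_lin : linear act.
  by move=> b m n; apply: (bij_inj (Mi k x)); rewrite linearP !Kact.
pose inv : {linear T -> T} := text (fun s => pure (map op s) \o linear_of
  act_lin).
have invK c : lact k x (inv c) = c.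
  move: c; apply: (tensor_eqT (f := lact k x \o inv) (g := idfun)) => s m /=.
  by rewrite textE /= lact_pure Kact /act_seq -map_comp (eq_map Kop) map_id.
have Kinv c : inv (lact k x c) = c.
  move: c; apply: (tensor_eqT (f := inv \o lact k x) (g := idfun)) => s m /=.
  by rewrite lact_pure textE /= actK /act_seq -map_comp (eq_map opK) map_id.
have size_inv n c : c \in supported (of_size n) -> inv c \in supported (of_size
  n).
  apply: tensor_inT => s m sn; rewrite textE supported_pure //.
  by rewrite /of_size size_map.
have d_inv c : d (inv c) = inv (d c).
  by rewrite -[LHS]Kinv -d_lact invK.
apply/bij_inj_surj; split; last first.
  move=> q; have [z <-] := hom_class_surj q.
  have /cycP[zl dz] := cyc_val_in z.
  have [|z' z'E] := @cyc_valP l (inv (cyc_val l z)).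
    by apply/cycP; rewrite size_inv // d_inv dz linear0.
  exists (hom_class l z'); rewrite -hom_class_act; congr (hom_class l _).
  by apply: val_inj; rewrite -[LHS]/(lact k x (cyc_val l z')) z'E invK.
suff inj0 q : xact k x q = 0 :> hommod l -> q = 0.
  move=> q1 q2 e; apply/eqP; rewrite -subr_eq0; apply/eqP/inj0.
  by rewrite linearB e subrr.
have [z <-] := hom_class_surj q; rewrite -hom_class_act => /hom_class_eq0.
rewrite cyc_val_act => /bndP[u ul du]; apply/hom_class_eq0/bndP.
by exists (inv u); rewrite ?size_inv // d_inv du [inv _]Kinv.
Qed.

(* The boundary of the duplicated z lacks the face [top] of the boundary of z,
   but that face is a compound action and so vanishes in homology. *)
Lemma lead_d_Dup j l (z : TT) :
  z \in supported (of_size j.+1) -> z \in coeffs_in (cyc l) ->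
  lead j (d (Dup z)) - (-1) ^+ l.+1 *: nondeg_part (dseq a z : TT)
    \in coeffs_in (bnd l).
Proof.
move=> zj zc.
have zl : z \in coeffs_in (supported (of_size l)).
  by apply/coeffs_inP => k; have /coeffs_inP/(_ k)/cycP[] := zc.
have dz0 : tmap d z = 0.
  apply/malgP => k; rewrite coeff_tmap coeff0.
  by have /coeffs_inP/(_ k)/cycP[] := zc.
have topB : top a z \in coeffs_in (bnd l).
  apply: (tensor_in _ (supportedT z) zc) => -[|y t] c _ cc.
    by rewrite top_nil rpred0.
  by rewrite top_cons coeffs_in_pure // lcact_bnd.
have lowE' : lead j (Dup (low a z)) = nondeg_part (low a z).
  case: j zj => [|j] zj; first by rewrite low_size1 // !linear0.
  by rewrite lead_Dup // size_low.
rewrite (d_Dup a zl) dz0 linear0 add0r linearZZ lowE' -scalerBr lowE.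
by rewrite (linearB nondeg_part) addrAC subrr add0r rpredZ // rpredN
  nondeg_part_coeffs.
Qed.

(** The next differential of the filtration: [lead_d_Dup] for any chain whose leading coefficients
    are cycles. By [lead_d] the remainder [c - Dup z] contributes only boundaries in the
    coefficients. *)
Lemma lead_d_next j l c :
  c \in supported (deg_take j.+2) -> c \in supported (of_size (j.+2 + l)) ->
  tmap d (lead j.+1 c) = 0 ->
  lead j (d c) - (-1) ^+ l.+1 *: nondeg_part (dseq a (lead j.+1 c) : TT)
    \in coeffs_in (bnd l).
Proof.
move=> cj cl dc0; set z := lead j.+1 c.
have zl : z \in coeffs_in (supported (of_size l)).
  by have := lead_coeffs j.+1 cl; rewrite addKn.
have zc : z \in coeffs_in (cyc l).
  apply/coeffs_inP => k; apply/cycP; split; first by have /coeffs_inP := zl.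
  by rewrite -coeff_tmap dc0 coeff0.
have := lead_d_Dup (size_lead j.+1 c) zc; rewrite -/z => zB.
have c'j : c - Dup z \in supported (deg_take j.+1) by exact: sub_lead.
have c'l : c - Dup z \in supported (of_size (j.+2 + l)).
  by rewrite rpredB // (@size_Dup _ _ _ _ j.+1 l) // size_lead.
have -> : lead j (d c) = tmap d (lead j (c - Dup z)) + lead j (d (Dup z)).
  by rewrite -(lead_d a c'j c'l) -linearD -linearD subrK.
rewrite -addrA rpredD //; apply/coeffs_inP => k; rewrite coeff_tmap; apply/bndP.
exists (lead j (c - Dup z))@_k => //.
have /coeffs_inP := lead_coeffs j c'l.
by rewrite (_ : j.+2 + l - j.+1 = l.+1)%N; [exact | lia].
Qed.

(** For coefficients that are cycles only the [low] term of [d_Dup] remains, one filtration step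
    below [Dup z]. *)
Lemma d_Dup_deg j l (z : TT) :
  z \in supported (of_size j.+1) -> z \in coeffs_in (cyc l) ->
  d (Dup z) \in supported (deg_take j.+1).
Proof.
move=> zj zc.
have zl : z \in coeffs_in (supported (of_size l)).
  by apply/coeffs_inP => k; have /coeffs_inP/(_ k)/cycP[] := zc.
have dz0 : tmap d z = 0.
  apply/malgP => k; rewrite coeff_tmap coeff0.
  by have /coeffs_inP/(_ k)/cycP[] := zc.
rewrite (d_Dup a zl) dz0 linear0 add0r rpredZ //.
case: j zj => [|j] zj; first by rewrite low_size1 // linear0 rpred0.
by apply: deg_Dup; apply: size_low.
Qed.

(** The leading coefficients are lifted through [d]; by [lead_d] the duplicated lift [e] has a
    boundary with the same leading term as [c]. *)
Lemma kill_lead j l c :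
  c \in supported (deg_take j.+1) -> c \in supported (of_size (j.+1 + l)) ->
  lead j c \in coeffs_in (bnd l) ->
  exists e, [/\ e \in supported (deg_take j.+1),
    e \in supported (of_size (j.+1 + l).+1) & c - d e \in supported (deg_take
      j)].
Proof.
move=> cj cl cB.
case: j cj cl cB => [|j] cj cl cB.
  by exists 0; rewrite !rpred0 linear0 (deg_take1_eq0 cj) subr0 rpred0.
have [k|t [tP tl tE]] := tmap_lift (f := d) (W := supported (of_size l.+1))
    (supportedI (size_lead j.+1 c) (nondeg_lead j.+1 c)).
  by have /coeffs_inP/(_ k)/bndP[u ul <-] := cB; exists u.
have tj : t \in supported (of_size j.+1).
  by apply: supported_sub tP => s /andP[].
have tN : t \in supported (@nondeg X).
  by apply: supported_sub tP => s /andP[].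
have ej := deg_Dup tj.
have el : Dup t \in supported (of_size (j.+2 + l).+1).
  by have := size_Dup tj tl; rewrite addnS.
exists (Dup t); split=> //; apply: deg_lead0.
  by rewrite rpredB // d_deg_take.
by rewrite linearB (lead_d a ej el) lead_Dup // nondeg_part_id // tE subrr.
Qed.

End SeqHomology.
Arguments cyc_val {r R a X M l}.
Arguments hom_class {r R a X M l}.

(** * Comparison along a homomorphism *)

Section Comparison.
Variables (r : nat) (R : comPzRingType) (a : 'I_r -> R) (X X' : multispindle r).
Variables (phi : ms_hom X X') (M : xmodule R X').

Implicit Types j l n : nat.
Local Notation MX := (pullback phi M).
Local Notation push := (lpush (phi := phi) (M := M)).
Local Notation TT := (seq_chains (seqmod MX)).
Local Notation TT' := (seq_chains (seqmod M)).

Definition coeff_push : {linear seqmod MX -> pullback phi (seqmod M)} := push.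

Definition push2 (z : TT) : TT' :=
  lpush (phi := phi) (M := seqmod M) (tmap coeff_push z).

Lemma push2_pure s c : push2 (pure s c) = pure (map phi s) (push c).
Proof. by rewrite /push2 tmap_pure (@lpush_pure _ _ _ _ phi (seqmod M)). Qed.

Fact push2_linear : linear push2.
Proof. by move=> b z1 z2; rewrite /push2 !linearP. Qed.

Lemma push_Dup z : push (Dup z) = Dup (push2 z).
Proof.
move: z; apply: (tensor_eqT (f := push \o Dup) (g := Dup \o linear_of
  push2_linear)).
move=> [|y t] c /=; first by rewrite push2_pure !Dup_nil linear0.
rewrite push2_pure !Dup_cons; elim: t y => [|x t IHt] y /=;
  rewrite !lpush_hcons //.
by rewrite IHt.
Qed.

Lemma size_push2 n z : z \in supported (of_size n) -> push2 z \in supported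
  (of_size n).
Proof. by move=> zn; apply: size_lpush; apply: supported_tmap. Qed.

Lemma push_deg_take j c : c \in supported (deg_take j) ->
  push c \in supported (deg_take j).
Proof. by apply: supported_lpush => s; exact: deg_take_map. Qed.

(** The projection is needed because [phi] may identify neighbouring entries, which creates an
    earlier repetition. *)
Lemma lead_push j c : c \in supported (deg_take j.+1) ->
  lead j (push c) = nondeg_part (push2 (lead j c)).
Proof.
move=> cj; have {1}-> : c = Dup (lead j c) + (c - Dup (lead j c)).
  by rewrite addrC subrK.
rewrite linearD push_Dup linearD.
rewrite [lead j (push (_ - _))]lead_deg ?push_deg_take ?sub_lead // addr0.
case: j cj => [/deg_take1_eq0 ->|j _].
  by rewrite (linear0 (lead 0)) /push2 !linear0.
by rewrite lead_Dup // size_push2 // size_lead.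
Qed.

Lemma push_cyc l c : c \in cyc a (M := MX) l -> push c \in cyc a (M := M) l.
Proof. by case/cycP=> cl dc; apply/cycP;
  rewrite size_lpush // -lpush_d dc linear0. Qed.

Lemma push_bnd l c : c \in bnd a (M := MX) l -> push c \in bnd a (M := M) l.
Proof.
by case/bndP=> u ul <-; apply/bndP; exists (push u);
  rewrite ?size_lpush ?lpush_d.
Qed.

Definition cyc_push l : {linear cycmod a MX l -> pullback phi (cycmod a M l)} :=
  Defs.sub_map (W := cyc a (M := MX) l) (W' := cyc a (M := M) l) (f := push)
    (@push_cyc l).

Lemma cyc_val_push l z : cyc_val (cyc_push l z) = push (cyc_val z).
Proof. by []. Qed.

Lemma cyc_push_act l k x z : cyc_push l (xact k x z) = xact k x (cyc_push l z).
Proof. by apply: val_inj; rewrite /= lpush_lact. Qed.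

(** Defined on cycles, where leading terms live. Under [hom_inj] its kernel consists of the
    boundaries, and under [hom_surj] it is onto. *)
Definition hom_push l : {linear cycmod a MX l -> pullback phi (hommod a M l)} :=
  (hom_class : {linear pullback phi (cycmod a M l) -> pullback phi (hommod a M
    l)}) \o cyc_push l.

Lemma hom_push_act l k x z : hom_push l (xact k x z) = xact k x (hom_push l z).
Proof. by rewrite /hom_push /= cyc_push_act (hom_class_act _ (phi x)). Qed.

Lemma hom_push_eq0 l (z : cycmod a MX l) :
  hom_push l z = 0 <-> push (cyc_val z) \in bnd a l.
Proof. exact: (hom_class_eq0 (cyc_push l z)). Qed.

Definition hom_inj l := forall u, u \in cyc a (M := MX) l ->
  push u \in bnd a (M := M) l -> u \in bnd a (M := MX) l.

Definition hom_surj l := forall w, w \in cyc a (M := M) l ->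
  exists2 u, u \in cyc a (M := MX) l & w - push u \in bnd a (M := M) l.

Lemma tmap_hom_push0 l (z : seq_chains (cycmod a MX l)) :
  tmap cyc_val z \in coeffs_in (bnd a (M := MX) l) -> tmap (hom_push l) z = 0.
Proof.
move=> /coeffs_inP zB; apply/malgP => k; rewrite coeff_tmap coeff0.
by apply/hom_push_eq0/push_bnd; rewrite -coeff_tmap.
Qed.

Lemma tmap_hom_push_inj l (z : seq_chains (cycmod a MX l)) : hom_inj l ->
  tmap (hom_push l) z = 0 -> tmap cyc_val z \in coeffs_in (bnd a (M := MX) l).
Proof.
move=> inj_l z0; apply/coeffs_inP => k; rewrite coeff_tmap.
apply: inj_l (cyc_val_in _) _; apply/hom_push_eq0.
by rewrite -coeff_tmap z0 coeff0.
Qed.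

Lemma tmap_hom_class0 l (z : seq_chains (cycmod a M l)) :
  tmap hom_class z = 0 <-> tmap cyc_val z \in coeffs_in (bnd a (M := M) l).
Proof.
split=> [z0|/coeffs_inP zB].
  apply/coeffs_inP => k; rewrite coeff_tmap; apply/hom_class_eq0.
  by rewrite -coeff_tmap z0 coeff0.
apply/malgP => k; rewrite coeff_tmap coeff0; apply/hom_class_eq0.
by rewrite -coeff_tmap.
Qed.

Lemma hom_push_surj l h : hom_surj l -> exists z, hom_push l z = h.
Proof.
move=> surj_l; have [w <-] := hom_class_surj h.
have [u uc wu] := surj_l _ (cyc_val_in w); have [z zE] := cyc_valP uc.
exists z; apply/eqP; rewrite eq_sym -subr_eq0; apply/eqP.
rewrite -[hom_push l z]/(hom_class (cyc_push l z : cycmod a M l)) -linearB.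
by apply/hom_class_eq0; rewrite linearB cyc_val_push zE.
Qed.

End Comparison.
Arguments cyc_push {r R a X X' phi M l}.
Arguments hom_push {r R a X X' phi M l}.

(** * Exactness of mapping cones *)

Section ExactCones.
Variables (r : nat) (R : comPzRingType) (a : 'I_r -> R) (X X' : multispindle r).
Variables (phi : ms_hom X X') (M : xmodule R X').

Local Notation MX := (pullback phi M).
Local Notation push := (lpush (phi := phi) (M := M)).
Local Notation d := (dseq a).
Local Notation size_in n := (supported (of_size n)).
Local Notation degen := (supported (@deg _)).

(* Exactness of the mapping cone of push in one degree: injectivity on the
   homology at length n together with surjectivity at length n + 1. *)
Definition full_exact n := forall (al : seq_chains MX) (be : seq_chains M),
  al \in size_in n -> be \in size_in n.+1 -> d al = 0 -> push al = d be ->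
  exists al' be', [/\ al' \in size_in n.+1, be' \in size_in n.+2,
    d al' = al & be = push al' + d be'].

Definition degen_exact n := forall (al : seq_chains MX) (be : seq_chains M),
  al \in size_in n -> be \in size_in n.+1 -> al \in degen -> be \in degen ->
  d al = 0 -> push al = d be ->
  exists al' be', [/\ al' \in size_in n.+1, be' \in size_in n.+2,
    (al' \in degen /\ be' \in degen), d al' = al & be = push al' + d be'].

(* For n = 0 this only expresses surjectivity on H^N_0: in the complexes of
   the theorem there are no chains on the empty sequence. *)
Definition normal_exact n := forall (al : seq_chains MX) (be : seq_chains M),
  al \in size_in n -> be \in size_in n.+1 -> (n = 0%N -> al = 0) ->
  d al \in degen -> ((0 < n)%N -> push al - d be \in degen) ->
  exists al' be', [/\ al' \in size_in n.+1, be' \in size_in n.+2,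
    (0 < n)%N -> al - d al' \in degen & be - push al' - d be' \in degen].

Lemma push_size0_inj (c : seq_chains MX) : c \in size_in 0 -> push c = 0 -> c =
  0.
Proof.
move=> /supportedP c0; have -> : c = pure [::] c@_([::]).
  by apply/malgP => s; rewrite coeff_pure; case: s => // x s; rewrite c0.
rewrite (@lpush_pure _ _ _ _ phi M) => c00.
have : (pure [::] c@_([::]) : seq_chains M)@_([::]) = 0 by rewrite c00 coeff0.
by rewrite coeff_pure eqxx => ->; rewrite linear0.
Qed.

(** The pair is first bounded modulo degenerate chains; what remains is a degenerate cycle of the
    cone and is bounded there. *)
Lemma normal_degen_full n : normal_exact n -> degen_exact n -> full_exact n.
Proof.
move=> Nn Dn al be aln ben dal albe.
case: n => [|n] in Nn Dn aln ben *.
  (* Chains of length 1 have no degenerate part, so [be] is reached exactly; then [d al' = al]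
     follows because on the empty list [push] is the identity of M. *)
  have [|//|al' [be' [al'1 be'2 _ beE]]] := Nn 0 be (rpred0 _) ben (fun=>
    erefl).
    by rewrite linear0 rpred0.
  have {}beE : be = push al' + d be'.
    apply/eqP; rewrite -subr_eq0 opprD addrA; apply/eqP/deg_size1_eq0 => //.
    by rewrite !rpredB ?size_lpush // size_d.
  exists al', be'; split=> //; apply/eqP; rewrite -subr_eq0; apply/eqP.
  apply: push_size0_inj; first by rewrite rpredB // size_d.
  by rewrite linearB albe lpush_d beE linearD ddK addr0 subrr.
have [|||al' [be' [al'n be'n /(_ isT) alD beD]]] := Nn al be aln ben => //.
- by rewrite dal rpred0.
- by rewrite albe subrr rpred0.
have [||||||al'' [be'' [al''n be''n _ alE beE]]] :=
  Dn (al - d al') (be - push al' - d be') => //.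
- by rewrite rpredB // size_d.
- by rewrite !rpredB ?size_lpush // size_d.
- by rewrite linearB dal ddK subrr.
- by rewrite linearB albe !linearB lpush_d ddK subr0.
exists (al' + al''), (be' + be''); split; rewrite ?rpredD //.
  by rewrite linearD alE addrC subrK.
rewrite !linearD addrACA -beE.
by rewrite -[be - _ - _]addrA -opprD addrC subrK.
Qed.

End ExactCones.

(** * Lowering the filtration of a cone cycle *)

Section ComparisonStep.
Variables (r : nat) (R : comPzRingType) (a : 'I_r -> R) (X X' : multispindle r).
Variables (phi : ms_hom X X') (M : xmodule R X').

Local Notation MX := (pullback phi M).
Local Notation push := (lpush (phi := phi) (M := M)).
Local Notation d := (dseq a).
Local Notation size_in n := (supported (of_size n)).
Local Notation degen := (supported (@deg _)).
Implicit Types l p n : nat.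

Lemma lead_cyc (Y : multispindle r) (N : xmodule R Y) j l (c : seq_chains N) :
  c \in supported (deg_take j.+1) -> c \in size_in (j.+1 + l) ->
  lead j (d c) = 0 -> lead j c \in coeffs_in (cyc a (M := N) l).
Proof.
move=> cj cl; rewrite (lead_d a cj cl) => dc0; apply/coeffs_inP => k;
  apply/cycP.
split; last by rewrite -coeff_tmap dc0 coeff0.
by have /coeffs_inP := lead_coeffs j cl; rewrite addKn; exact.
Qed.

Lemma lift_cyc (Y : multispindle r) (N : xmodule R Y) P l
    (z : seq_chains (seqmod N)) :
  z \in supported P -> z \in coeffs_in (cyc a (M := N) l) ->
  exists2 z' : seq_chains (cycmod a N l), z' \in supported P & tmap cyc_val z'
    = z.
Proof.
move=> zP /coeffs_inP zc; apply: tmap_surj => // k.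
exact: cyc_valP.
Qed.

Lemma push_cyc_val l (z : seq_chains (cycmod a MX l)) :
  push2 (tmap cyc_val z)
    = tmap cyc_val (lpush (phi := phi) (M := cycmod a M l) (tmap cyc_push z)).
Proof.
rewrite -(@lpush_tmap _ _ _ _ phi (cycmod a M l) (seqmod M) cyc_val) /push2.
congr (lpush _); rewrite !tmap_comp; apply: eq_tmap => c.
exact: cyc_val_push.
Qed.

Lemma push_hom_push l (z : seq_chains (cycmod a MX l)) :
  lpush (phi := phi) (M := hommod a M l) (tmap hom_push z)
    = tmap hom_class (lpush (phi := phi) (M := cycmod a M l) (tmap cyc_push z)).
Proof.
rewrite -(@lpush_tmap _ _ _ _ phi (cycmod a M l) (hommod a M l) hom_class).
congr (lpush _); rewrite tmap_comp; exact: eq_tmap.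
Qed.

Let sgnK l (V : lmodType R) (v : V) : (-1) ^+ l *: ((-1) ^+ l *: v) = v.
Proof. by rewrite scalerA -exprD addnn -signr_odd odd_double scale1r. Qed.

Let deg_takeD (Y : multispindle r) (N : xmodule R Y) j (c : seq_chains N) :
  c \in supported (deg_take j) -> c \in degen.
Proof. by apply: supported_sub => s; exact: deg_takeW. Qed.

Let deg_takeS (Y : multispindle r) (N : xmodule R Y) j (c : seq_chains N) :
  c \in supported (deg_take j) -> c \in supported (deg_take j.+1).
Proof. by apply: supported_sub => s; exact: deg_take_leq. Qed.

(** The leading terms of the pair give a cone cycle over the homology module, which [exact_p]
    bounds. Lifting the bounding pair to chains and correcting the coefficients by boundaries lowers
    both filtrations by one. *)
Lemma comparison_step p l (al : seq_chains MX) (be : seq_chains M) :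
  hom_inj a phi M l -> hom_surj a phi M l ->
  normal_exact a phi (hommod a M l) p ->
  al \in size_in (p.+1 + l) -> be \in size_in (p.+2 + l) ->
  al \in supported (deg_take p.+1) -> be \in supported (deg_take p.+2) ->
  d al = 0 -> push al = d be ->
  exists e f, [/\ e \in size_in (p.+2 + l), f \in size_in (p.+3 + l),
    (e \in degen /\ f \in degen), al - d e \in supported (deg_take p)
    & be - push e - d f \in supported (deg_take p.+1)].
Proof.
move=> inj_l surj_l exact_p al_n be_n al_p be_p dal albe.
pose eps : R := (-1) ^+ l.+1.
have epsK (V : lmodType R) (v : V) : eps *: (eps *: v) = v by exact: sgnK.
set x := lead p al; set y := lead p.+1 be.
have xc : x \in coeffs_in (cyc a (M := MX) l).
  by apply: lead_cyc al_p al_n _; rewrite dal linear0.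
(* [d be = push al] lies in filtration p + 1, where [lead p.+1] vanishes. *)
have yc : y \in coeffs_in (cyc a (M := M) l).
  by apply: lead_cyc be_p be_n _; rewrite -albe lead_deg // push_deg_take.
have [x' x'P x'E] := lift_cyc (supportedI (size_lead p al) (nondeg_lead p al))
  xc.
have x'p : x' \in size_in p by apply: supported_sub x'P => s /andP[].
have x'N : x' \in supported (@nondeg X) by apply: supported_sub x'P => s
  /andP[].
have [y' y'P y'E] := lift_cyc (supportedI (size_lead p.+1 be) (nondeg_lead p.+1
  be)) yc.
have y'p : y' \in size_in p.+1 by apply: supported_sub y'P => s /andP[].
have y'N : y' \in supported (@nondeg X') by apply: supported_sub y'P => s
  /andP[].
(* The classes of the leading terms form a cycle of the cone of phi on the
   normalized chains with coefficients in the homology. *)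
have dxB : nondeg_part (d x) \in coeffs_in (bnd a (M := MX) l).
  rewrite /x; case: (p) al_p al_n => [|j] al_p al_n.
    by rewrite (deg_take1_eq0 al_p) !linear0 rpred0.
  have dx0 : tmap d (lead j.+1 al) = 0 by rewrite -(lead_d a al_p al_n) dal
    linear0.
  have := lead_d_next al_p al_n dx0; rewrite dal linear0 sub0r rpredN.
  by move=> /(rpredZ eps); rewrite epsK.
(* [lead_d_next] for [be], where [lead_push] turns [lead p (d be)] into the pushed leading term of
   [al]. *)
have dyB : eps *: nondeg_part (push2 x) - nondeg_part (d y) \in coeffs_in (bnd
  a (M := M) l).
  have dy0 : tmap d y = 0 by rewrite -(lead_d a be_p be_n) -albe lead_deg //
    push_deg_take.
  have := lead_d_next be_p be_n dy0;
    rewrite -albe lead_push // => /(rpredZ eps).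
  by rewrite scalerBr epsK.
pose al' := tmap hom_push x' : seq_chains (pullback phi (hommod a M l)).
(* The factor [eps] absorbs the sign in [lead_d_next], so the pair meets the unsigned cone
   condition. *)
pose be' := eps *: tmap hom_class y' : seq_chains (hommod a M l).
have [|||||e' [f' [e'p f'p e'E f'E]]] := exact_p al' be'.
- exact: supported_tmap.
- by rewrite rpredZ // supported_tmap.
- move=> p0; apply: tmap_hom_push0; rewrite x'E /x.
  by rewrite p0 in al_p *; rewrite (deg_take1_eq0 al_p) linear0 rpred0.
- apply/nondeg_part_eq0; rewrite /al' -(tmap_d a (@hom_push_act _ _ _ _ _ _ _
  _)).
  rewrite -tmap_nondeg_part; apply: tmap_hom_push0.
  by rewrite tmap_nondeg_part (tmap_d a (@cyc_val_act _ _ _ _ _ _)) x'E.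
- move=> _; apply/nondeg_part_eq0.
  rewrite /al' push_hom_push /be' linearZZ -(tmap_d a (@hom_class_act _ _ _ _ _
    _)).
  rewrite -linearZZ -linearB -tmap_nondeg_part; apply/tmap_hom_class0.
  rewrite tmap_nondeg_part linearB -push_cyc_val x'E linearZZ.
  rewrite (tmap_d a (@cyc_val_act _ _ _ _ _ _)) y'E.
  have -> : push2 x - eps *: d y = eps *: (eps *: push2 x - d y).
    by rewrite scalerBr epsK.
  by rewrite linearZZ rpredZ // linearB linearZZ.
(* The bounding pair is lifted from homology coefficients to cycles: over X by [hom_surj], over X'
   by choosing representatives. *)
have [e1 e1p e1E] : exists2 e1 : seq_chains (cycmod a MX l),
    e1 \in size_in p.+1 & tmap hom_push e1 = e'.
  by apply: tmap_surj => // k; exact: hom_push_surj.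
have [f1 f1p f1E] : exists2 f1 : seq_chains (cycmod a M l),
    f1 \in size_in p.+2 & tmap hom_class f1 = f'.
  by apply: tmap_surj => // k; exact: hom_class_surj.
pose u := tmap cyc_val e1 : seq_chains (seqmod MX).
pose v := tmap cyc_val f1 : seq_chains (seqmod M).
have up : u \in size_in p.+1 by exact: supported_tmap.
have vp : v \in size_in p.+2 by exact: supported_tmap.
have uc : u \in coeffs_in (cyc a (M := MX) l).
  by apply/coeffs_inP => k; rewrite coeff_tmap; exact: cyc_val_in.
have vc : v \in coeffs_in (cyc a (M := M) l).
  by apply/coeffs_inP => k; rewrite coeff_tmap; exact: cyc_val_in.
have ul : u \in coeffs_in (supported (of_size l)).
  by apply/coeffs_inP => k; have /coeffs_inP/(_ k)/cycP[] := uc.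
have vl : v \in coeffs_in (supported (of_size l)).
  by apply/coeffs_inP => k; have /coeffs_inP/(_ k)/cycP[] := vc.
have Dup_u : Dup u \in size_in (p.+2 + l) by exact: (size_Dup up ul).
have Dup_v : Dup v \in size_in (p.+3 + l) by exact: (size_Dup vp vl).
have uB : (0 < p)%N -> x - nondeg_part (d u) \in coeffs_in (bnd a (M := MX) l).
  move=> /e'E /nondeg_part_eq0 e'0.
  have -> : x - nondeg_part (d u) = tmap cyc_val (x' - nondeg_part (d e1)).
    rewrite linearB x'E tmap_nondeg_part.
    by rewrite (tmap_d a (@cyc_val_act _ _ _ _ _ _)).
  apply: tmap_hom_push_inj => //; rewrite linearB tmap_nondeg_part.
  rewrite (tmap_d a (@hom_push_act _ _ _ _ _ _ _ _)) e1E -[RHS]e'0 linearB.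
  by rewrite [nondeg_part al']nondeg_part_id // supported_tmap.
have vB : eps *: y - nondeg_part (push2 u) - nondeg_part (d v)
    \in coeffs_in (bnd a (M := M) l).
  have /nondeg_part_eq0 f'0 := f'E.
  have -> : eps *: y - nondeg_part (push2 u) - nondeg_part (d v) = tmap cyc_val
      (eps *: y' - nondeg_part (lpush (phi := phi) (M := cycmod a M l) (tmap
        cyc_push e1))
        - nondeg_part (d f1)).
    rewrite !linearB linearZZ y'E !tmap_nondeg_part -push_cyc_val.
    by rewrite (tmap_d a (@cyc_val_act _ _ _ _ _ _)).
  apply/tmap_hom_class0; rewrite -[RHS]f'0 !linearB !tmap_nondeg_part
    -push_hom_push e1E.
  rewrite (tmap_d a (@hom_class_act _ _ _ _ _ _)) f1E linearZZ.
  by rewrite [nondeg_part be']nondeg_part_id // rpredZ // supported_tmap.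
(* By [uB] and [lead_d_Dup] the leading coefficients of [al - eps *: d (Dup u)] are boundaries, so
   [kill_lead] removes them; for p = 0 the chain is already 0. *)
have [t1 [t1_p t1_n t1E]] : exists t1, [/\ t1 \in supported (deg_take p.+1),
    t1 \in size_in (p.+2 + l) & al - eps *: d (Dup u) - d t1 \in supported
      (deg_take p)].
  apply: kill_lead.
  - by rewrite rpredB // rpredZ // (d_Dup_deg up uc).
  - by rewrite rpredB // rpredZ // size_d.
  case: (posnP p) => [p0|p_gt0].
    rewrite (deg_take1_eq0 (c := _ - _)) ?linear0 ?rpred0 //.
    by rewrite rpredB ?rpredZ //; [move: al_p;
      rewrite p0 | have := d_Dup_deg up uc; rewrite p0].
  have := lead_d_Dup up uc; rewrite -/eps => /(rpredZ (- eps)) uB'.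
  have := rpredD (uB p_gt0) uB'.
  rewrite scalerBr !scaleNr epsK opprK addrACA addNr addr0.
  by rewrite linearB (linearZZ (lead p)).
pose e := eps *: Dup u + t1.
have e_p : e \in supported (deg_take p.+2).
  by rewrite rpredD ?rpredZ ?deg_Dup // deg_takeS.
have e_n : e \in size_in (p.+2 + l) by rewrite rpredD ?rpredZ.
(* The same for [be]; the correction [t1] does not disturb the leading term, since [push t1] lies in
   filtration p + 1. *)
have [t2 [t2_p t2_n t2E]] : exists t2, [/\ t2 \in supported (deg_take p.+2),
    t2 \in size_in (p.+3 + l)
    & be - push e - d (Dup v) - d t2 \in supported (deg_take p.+1)].
  apply: kill_lead.
  - by rewrite !rpredB ?push_deg_take // (d_Dup_deg vp vc).
  - by rewrite !rpredB ?size_lpush // size_d.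
  have := lead_d_Dup vp vc; rewrite -/eps -rpredN => vB'.
  have := rpredD (rpredZ eps vB) vB'.
  have -> : lead p.+1 (be - push e - d (Dup v))
      = y - eps *: nondeg_part (push2 u) - lead p.+1 (d (Dup v)).
    rewrite !(linearB (lead p.+1)) (linearD push) (linearD (lead p.+1)).
    rewrite [lead _ (push t1)]lead_deg ?push_deg_take // addr0.
    by rewrite (linearZZ push) (linearZZ (lead p.+1)) push_Dup lead_Dup
      ?size_push2.
  by rewrite !scalerBr epsK opprB addrA subrK.
exists e, (Dup v + t2); split.
- exact: e_n.
- by rewrite rpredD.
- by split; [exact: deg_takeD e_p | rewrite rpredD ?(deg_takeD (deg_Dup vp))
  ?(deg_takeD t2_p)].
- by rewrite linearD linearZZ opprD addrA.
- by rewrite [d (_ + t2)]linearD opprD addrA.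
Qed.

End ComparisonStep.

(** * Induction on length and filtration *)

Section DegenerateExactness.
Variables (r : nat) (R : comPzRingType) (a : 'I_r -> R) (X X' : multispindle r).
Variables (phi : ms_hom X X') (M : xmodule R X').

Local Notation MX := (pullback phi M).
Local Notation push := (lpush (phi := phi) (M := M)).
Local Notation d := (dseq a).
Local Notation size_in n := (supported (of_size n)).
Local Notation degen := (supported (@deg _)).
Implicit Types l p n : nat.

Lemma full_hom_inj l : full_exact a phi M l -> hom_inj a phi M l.
Proof.
move=> exl u /cycP[ul du] /bndP[w wl dw].
have [u' [w' [u'l w'l du' _]]] := exl u w ul wl du (esym dw).
by apply/bndP; exists u'.
Qed.

(** A cycle [w] of length l is a cone cycle paired with 0 in length l - 1. For l = 0 the map [push]
    is the identity of M. *)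
Lemma full_hom_surj l : (forall m, m.+1 = l -> full_exact a phi M m) ->
  hom_surj a phi M l.
Proof.
case: l => [_|l exl] w /cycP[wl dw].
  exists (pure [::] w@_([::])).
    by apply/cycP; rewrite d_nil supported_pure.
  rewrite (@lpush_pure _ _ _ _ phi M) (_ : _ - _ = 0) ?rpred0 //.
  apply/eqP; rewrite subr_eq0; apply/eqP/malgP => s; rewrite coeff_pure.
  by case: s => // x s; move/supportedP: wl => ->.
have [||u' [w' [u'l w'l du' wE]]] := exl l erefl 0 w (rpred0 _) wl.
- exact: linear0.
- by rewrite linear0 dw.
exists u'; first by apply/cycP.
by apply/bndP; exists w'; rewrite // wE addrC addKr.
Qed.

(** Strong induction on the length, which supplies the comparison of homology in smaller lengths,
    and inside it induction on the filtration by [comparison_step]. *)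
Lemma degen_exact_all :
  (forall n, normal_exact a phi M n) ->
  (forall l n, normal_exact a phi (hommod a M l) n) ->
  forall n, degen_exact a phi M n.
Proof.
move=> exM exH n; elim/ltn_ind: n => n IHn.
have full m : (m < n)%N -> full_exact a phi M m.
  by move=> lt_mn; apply: normal_degen_full (exM m) (IHn m lt_mn).
suff filtered P (al : seq_chains MX) (be : seq_chains M) : (P <= n)%N ->
    al \in size_in n -> be \in size_in n.+1 ->
    al \in supported (deg_take P) -> be \in supported (deg_take P.+1) ->
    d al = 0 -> push al = d be ->
    exists al' be', [/\ al' \in size_in n.+1, be' \in size_in n.+2,
      (al' \in degen /\ be' \in degen), d al' = al & be = push al' + d be'].
  (* A degenerate list of length n repeats within its first n entries, so filtration n is
     everything. *)
  move=> al be aln ben alD beD; by apply: (filtered n) => //;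
    exact: deg_of_size.
elim: P al be => [|p IHp] al be le_pn aln ben alp bep dal albe.
  (* Filtrations 0 and 1 are zero, as a repetition needs two entries. *)
  have al0 : al = 0 by apply: supported0 alp => s; rewrite deg_take0.
  exists 0, 0; rewrite !rpred0 !linear0 addr0; split=> //.
  exact: deg_take1_eq0.
have nE : n = (p.+1 + (n - p.+1))%N by rewrite subnKC.
set l := (n - p.+1)%N in nE.
(* The coefficient part [u] is shorter than n, so full exactness at l and l - 1 gives injectivity
   and surjectivity on homology at l. *)
have lt_ln : (l < n)%N by lia.
have inj_l := full_hom_inj (full l lt_ln).
have surj_l : hom_surj a phi M l.
  by apply: full_hom_surj => m ml; apply: full; lia.
rewrite nE in aln ben *.
have [e [f [en fn [eD fD] al'p be'p]]] :=
  comparison_step inj_l surj_l (exH l p) aln ben alp bep dal albe.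
have [|||||||al' [be' [al'n be'n [al'D be'D] al'E be'E]]] :=
  IHp (al - d e) (be - push e - d f).
- exact: ltnW.
- by rewrite nE rpredB // size_d.
- by rewrite nE !rpredB ?size_lpush // size_d.
- exact: al'p.
- exact: be'p.
- by rewrite linearB dal ddK subrr.
- by rewrite linearB albe !linearB lpush_d ddK subr0.
rewrite nE in al'n be'n.
exists (e + al'), (f + be'); split; rewrite ?rpredD //.
  by rewrite linearD al'E addrC subrK.
by rewrite !linearD addrACA -be'E -[be - _ - _]addrA -opprD addrC subrK.
Qed.

End DegenerateExactness.

(** * Translation to the homology groups *)

Section HomologyMaps.
Variables (R : pzRingType) (C D : complex R) (f : chain_map C D) (n : nat).

Lemma homology_map_inj : injective (homology_map f n) <->
  (forall c, c \in @Defs.cycle R C n -> forall y, f n c = cdiff D n y ->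
     exists x, c = cdiff C n x).
Proof.
split=> [fi c cc y fc|fi p q e].
  have e0 : homology_map f n (qproj (@boundary R C n) (Submod cc)) = 0.
    rewrite /homology_map /= quot_map_proj; apply/qproj_eq0.
    by rewrite unfold_in; apply/asboolP; exists y.
  have := fi _ _ (etrans e0 (esym (linear0 (homology_map f n)))).
  by move/qproj_eq0; rewrite unfold_in => /asboolP.
suff inj0 z : homology_map f n z = 0 -> z = 0.
  by apply/eqP; rewrite -subr_eq0; apply/eqP/inj0; rewrite linearB e subrr.
rewrite -[z]qreprK; case: (qrepr z) => c cc.
rewrite /homology_map /= quot_map_proj => /qproj_eq0.
rewrite unfold_in => /asboolP[y /= fc]; apply/qproj_eq0; rewrite unfold_in.
by apply/asboolP; have [x cE] := fi c cc y fc; exists x.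
Qed.

Lemma homology_map_surj : (forall h, exists g, homology_map f n g = h) <->
  (forall c, c \in @Defs.cycle R D n -> exists2 b, b \in @Defs.cycle R C n &
     exists y, c - f n b = cdiff D n y).
Proof.
split=> [fs c cc|fs h].
  have [g] := fs (qproj (@boundary R D n) (Submod cc)).
  rewrite -[g]qreprK; case: (qrepr g) => b bc.
  rewrite /homology_map /= quot_map_proj => /esym/qproj_eq.
  by rewrite unfold_in => /asboolP[y yE]; exists b => //; exists y.
rewrite -[h]qreprK; case: (qrepr h) => c cc; have [b bc [y yE]] := fs c cc.
exists (qproj (@boundary R C n) (Submod bc)).
rewrite /homology_map /= quot_map_proj; apply/esym/qproj_eq.
by rewrite unfold_in; apply/asboolP; exists y.
Qed.

End HomologyMaps.

(** * Sequences as functions and as lists *)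

Section SequenceTranslation.
Variables (r : nat) (R : comPzRingType) (a : 'I_r -> R) (X : multispindle r).
Variable M : xmodule R X.

Definition seq_of n (x : {ffun 'I_n -> X}) : seq X := [seq x i | i <- enum
  'I_n].

Lemma size_seq_of n (x : {ffun 'I_n -> X}) : size (seq_of x) = n.
Proof. by rewrite size_map size_enum_ord. Qed.

Lemma nth_seq_of n (x : {ffun 'I_n -> X}) y (i : 'I_n) : nth y (seq_of x) i = x
  i.
Proof. by rewrite (nth_map i) ?size_enum_ord // nth_ord_enum. Qed.

Lemma seq_of_inj n : injective (@seq_of n).
Proof.
by move=> x y e; apply/ffunP => i; rewrite -(nth_seq_of x (x i)) e nth_seq_of.
Qed.

Lemma seq_ofP n s : size s = n -> exists x, @seq_of n x = s.
Proof.
move=> /eqP sn; exists [ffun i => tnth (Tuple sn) i];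
  rewrite -[RHS](map_tnth_enum (Tuple sn)).
by apply: eq_map => i; rewrite ffunE.
Qed.

Lemma seq_ofS n (x : {ffun 'I_n.+1 -> X}) :
  seq_of x = x ord0 :: seq_of [ffun i => x (lift ord0 i)].
Proof.
rewrite /seq_of enum_ordSl /= -map_comp; congr (_ :: _).
by apply: eq_map => i /=; rewrite ffunE.
Qed.

Lemma deg_seq_of n (x : {ffun 'I_n -> X}) : deg (seq_of x) = degenerate x.
Proof.
apply/idP/existsP => [|[i /existsP[j /andP[/eqP ji /eqP xij]]]].
  move=> xD; apply: contrapT => xN; case/negP: xD.
  case: n x xN => [|n] x xN; first by rewrite /seq_of enum_ord0.
  apply/(sortedP (x ord0)) => i; rewrite size_seq_of => lt_in.
  apply/negP => /eqP; rewrite (nth_seq_of x _ (Ordinal (ltnW lt_in))).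
  rewrite (nth_seq_of x _ (Ordinal lt_in)) => e; apply: xN.
  exists (Ordinal (ltnW lt_in)); apply/existsP; exists (Ordinal lt_in).
  by rewrite e !eqxx.
apply/negP => /(sortedP (x i))/(_ i); rewrite size_seq_of -ji ltn_ord.
by rewrite !nth_seq_of xij eqxx => /(_ isT).
Qed.

Definition to_seq n : {linear chains M n -> seq_chains M} :=
  text (fun x => pure (seq_of x)).

Lemma to_seq_pure n x m : @to_seq n (pure x m) = pure (seq_of x) m.
Proof. exact: textE. Qed.
Opaque to_seq.
Arguments to_seq {n}.

Lemma coeff_to_seq n c x : (@to_seq n c)@_(seq_of x) = c@_x.
Proof.
elim/tensor_ind: c => [|y m c IHc]; first by rewrite linear0 !coeff0.
rewrite linearD to_seq_pure !coeffD IHc !coeff_pure.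
by rewrite (inj_eq (@seq_of_inj n)).
Qed.

Lemma to_seq_inj n : injective (@to_seq n).
Proof.
by move=> c1 c2 e; apply/malgP => x; rewrite -!coeff_to_seq e.
Qed.

Lemma size_to_seq n c : @to_seq n c \in supported (of_size n).
Proof.
apply: tensor_inT (supportedT c) => x m _.
by rewrite to_seq_pure supported_pure // /of_size size_seq_of.
Qed.

Lemma to_seqP n c : c \in supported (of_size n) -> exists c', @to_seq n c' = c.
Proof.
move=> /allP cn; rewrite [c]tensor_sum.
elim: (enum_fset _) cn => [|s ss IHss] cn; first by exists 0;
  rewrite big_nil linear0.
have [|c' c'E] := IHss; first by move=> t ts; apply: cn; rewrite inE ts orbT.
have [x xE] := seq_ofP (eqP (cn s (mem_head _ _))).
by exists (pure x c@_s + c'); rewrite big_cons linearD to_seq_pure xE c'E.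
Qed.

Lemma deg_to_seq n c : (@to_seq n c \in supported (@deg X)) = (c \in @degen r R
  X M n).
Proof.
apply/supportedP/degenP => [cD x xN|cD s sN].
  by rewrite -coeff_to_seq cD // deg_seq_of.
case: (eqVneq (size s) n) => [sn|sn]; last first.
  by move/supportedP: (size_to_seq c) => ->.
have [x xE] := seq_ofP sn; rewrite -xE coeff_to_seq cD //.
by rewrite -deg_seq_of xE.
Qed.

(** By induction on n: the face i = 0 is the compound term of [bd], and the face i + 1 is x_0
    followed by the face i of the tail, with the same sign. *)
Lemma to_seq_bdry n c : to_seq (bdry a c : chains M n) = dseq a (to_seq c).
Proof.
move: c; apply: (tensor_eqT (f := @to_seq n \o @bdry r R a X M n)
  (g := dseq a \o @to_seq n.+1)) => x m /=.
rewrite to_seq_pure d_pure.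
have -> : to_seq (bdry a (pure x m)) = \sum_(k < r) a k *:
    \sum_(i < n.+1) (-1) ^+ (n - i) *: pure (seq_of (face_seq k i x)) (xact k
      (x i) m).
  rewrite /bdry linear_sum; apply: eq_bigr => k _; rewrite linearZZ;
    congr (_ *: _).
  rewrite /face_sum linear_sum; apply: eq_bigr => i _.
  by rewrite linearZZ face_pure to_seq_pure.
elim: n x m => [|n IHn] x m; rewrite seq_ofS /=; set x' := [ffun i => _];
  rewrite size_seq_of addrC lcactE scaler_sumr.
- rewrite [X in hcons _ X](_ : _ = 0) ?linear0 ?addr0; last first.
    by rewrite /seq_of enum_ord0.
  apply: eq_bigr => k _; rewrite big_ord1 !expr0 !scale1r lact_pure.
  by rewrite /act_seq /seq_of enum_ord0.
- rewrite -IHn (linear_sum (hcons _)) -big_split; apply: eq_bigr => k _ /=.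
  rewrite big_ord_recl scalerDr (linearZZ (hcons _)) (linear_sum (hcons _))
    subn0; congr (_ + _).
    rewrite !scalerA mulrC lact_pure; congr (_ *: pure _ _).
    rewrite /act_seq /seq_of -map_comp; apply: eq_map => i /=.
    by rewrite !ffunE leq0n.
  congr (_ *: _); apply: eq_bigr => i _.
  have liftS0 : lift (lift ord0 i) ord0 = ord0 :> 'I_n.+2 by exact: ord_inj.
  rewrite (linearZZ (hcons _)) hcons_pure lift0 subSS seq_ofS ffunE lift0
    liftS0 /=.
  rewrite [x' i]ffunE; congr (_ *: pure (_ :: seq_of _) _).
  apply/ffunP => j; rewrite !ffunE.
  have -> : lift (lift ord0 i) (lift ord0 j) = lift ord0 (lift i j).
    by apply: ord_inj; rewrite /= /bump; lia.
  by [].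
Qed.

End SequenceTranslation.
Arguments to_seq {r R X M n}.

(** * Cone exactness and the maps on homology *)

Section HomologyTranslation.
Variables (r : nat) (R : comPzRingType) (a : 'I_r -> R) (X X' : multispindle r).
Variables (phi : ms_hom X X') (M : xmodule R X').

Local Notation MX := (pullback phi M).
Local Notation d := (dseq a).

Lemma to_seq_push n (c : chains MX n) : to_seq (push c) = lpush (to_seq c).
Proof.
move: c; apply: (tensor_eqT (f := to_seq \o @push r R X X' phi M n)
  (g := lpush (phi := phi) (M := M) \o to_seq)) => x m /=.
rewrite (@push_pure _ _ _ _ phi M) !to_seq_pure (@lpush_pure _ _ _ _ phi M).
by rewrite /seq_of -map_comp; congr pure; apply: eq_map => i /=; rewrite ffunE.
Qed.

Lemma HN_injP n (al : chains MX n.+1) (be : chains M n.+2) :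
  injective (HN_map a phi M n) -> bdry a al \in @degen r R X MX n ->
  push al - bdry a be \in @degen r R X' M n.+1 ->
  exists u, al - bdry a u \in @degen r R X MX n.+1.
Proof.
move=> /homology_map_inj HNi alD albe.
have [||x] := HNi (qproj (@degen r R X MX n.+1) al) _
    (qproj (@degen r R X' M n.+2) be).
- case: n al be alD albe {HNi} => [//|n] al be alD _.
  by apply/eqP; rewrite /= quot_map_proj; apply/qproj_eq0.
- by rewrite /= !quot_map_proj; apply/qproj_eq.
rewrite -[x]qreprK /= quot_map_proj => /qproj_eq.
by exists (qrepr x).
Qed.

(** The guard [0 < n] reflects that every 0-chain is a cycle. *)
Lemma HN_surjP n (be : chains M n.+1) :
  (forall h, exists g, HN_map a phi M n g = h) ->
  ((0 < n)%N -> bdry a be \in @degen r R X' M n) ->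
  exists u v, ((0 < n)%N -> bdry a u \in @degen r R X MX n) /\
    be - push u - bdry a v \in @degen r R X' M n.+1.
Proof.
move=> /homology_map_surj HNs beD.
have [|x xc [y]] := HNs (qproj (@degen r R X' M n.+1) be).
  case: n be beD {HNs} => [//|n] be beD.
  by apply/eqP; rewrite /= quot_map_proj; apply/qproj_eq0/beD.
rewrite -[x]qreprK -[y]qreprK /= !quot_map_proj -linearB => /qproj_eq uv.
exists (qrepr x), (qrepr y); split=> // n_gt0.
case: n x xc n_gt0 {be beD HNs y uv} => // n x /eqP xc _.
by apply/qproj_eq0; rewrite -[RHS]xc -[in RHS](qreprK x) /= quot_map_proj.
Qed.

(** Injectivity in degree n bounds [al] by some [u]; then [be - push u] is a normalized cycle, and
    surjectivity in degree n + 1 treats it. Degree n means length n + 1, so length 0 uses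
    surjectivity alone. *)
Lemma normal_exact_HN : (forall n, bijective (HN_map a phi M n)) ->
  forall n, normal_exact a phi M n.
Proof.
move=> HNb n al be /to_seqP[{}al <-] /to_seqP[{}be <-] al0 alD beD.
have HNi m : injective (HN_map a phi M m) by exact: bij_inj.
have HNs m h : exists g, HN_map a phi M m g = h.
  by have [_] := proj1 (bij_inj_surj _) (HNb m); exact.
case: n => [|n] in al be al0 alD beD *.
  have [//|u [v [_ uv]]] := @HN_surjP 0 be (HNs 0).
  exists (to_seq u), (to_seq v); split=> //; rewrite ?size_to_seq //.
  by rewrite -to_seq_push -to_seq_bdry -!linearB deg_to_seq.
have {}alD : bdry a al \in @degen r R X MX n by rewrite -deg_to_seq to_seq_bdry.
have {}beD : push al - bdry a be \in @degen r R X' M n.+1.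
  by rewrite -deg_to_seq linearB to_seq_push to_seq_bdry; exact: beD.
have [u uD] := HN_injP (HNi n) alD beD.
have [|w [v [wD wv]]] := @HN_surjP n.+1 (be - push u) (HNs n.+1).
  move=> _; rewrite linearB /= -push_bdry -opprB rpredN.
  have -> : push (bdry a u) - bdry a be
      = (push al - bdry a be) - push (al - bdry a u).
    by rewrite linearB opprB [RHS]addrC addrA subrK.
  by rewrite rpredB // push_degen.
exists (to_seq (u + w)), (to_seq v); split; rewrite ?size_to_seq //.
  move=> _; rewrite -to_seq_bdry -linearB deg_to_seq linearD opprD addrA rpredB
    //.
  exact: wD.
rewrite -to_seq_push -to_seq_bdry -!linearB deg_to_seq.
by rewrite linearD opprD addrA.
Qed.

(** Exactness at length n + 1 gives injectivity on H^D_n; exactness at length n, applied with [al]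
    equal to 0, gives surjectivity. *)
Lemma degen_exact_HD : (forall n, degen_exact a phi M n) ->
  forall n, bijective (HD_map a phi M n).
Proof.
move=> ex n; apply/bij_inj_surj; split.
  apply/homology_map_inj => -[c cD] cc [y yD] /(congr1 val) /= cy.
  have dc : d (to_seq c) = 0.
    (* In degree 0 being a cycle is no condition, whereas [d] still maps length 1 to M; but a
       degenerate chain of length 1 is 0. *)
    case: n c cD cc y yD cy => [|n] c cD cc y yD cy.
      by rewrite (deg_size1_eq0 (c := to_seq c)) ?linear0 ?size_to_seq
        ?deg_to_seq.
    move: cc => /eqP/(congr1 val) /= dc.
    by rewrite -to_seq_bdry dc linear0.
  have cD' : to_seq c \in supported (@deg X) by rewrite deg_to_seq.
  have yD' : to_seq y \in supported (@deg X') by rewrite deg_to_seq.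
  have cy' : lpush (phi := phi) (M := M) (to_seq c) = d (to_seq y).
    by rewrite -to_seq_push cy to_seq_bdry.
  have [al' [be' [al'n _ [al'D _] al'E _]]] :=
    ex n.+1 _ _ (size_to_seq c) (size_to_seq y) cD' yD' dc cy'.
  have [x xE] := to_seqP al'n; rewrite -xE deg_to_seq in al'D.
  exists (Submod al'D); apply/val_inj/(@to_seq_inj _ _ _ _ _ c (bdry a x)).
  by rewrite to_seq_bdry xE al'E.
apply/homology_map_surj => -[c cD] cc.
have dc : d (to_seq c) = 0.
  case: n c cD cc => [|n] c cD cc.
    by rewrite (deg_size1_eq0 (c := to_seq c)) ?linear0 ?size_to_seq
      ?deg_to_seq.
  move: cc => /eqP/(congr1 val) /= dc.
  by rewrite -to_seq_bdry dc linear0.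
have cD' : to_seq c \in supported (@deg X') by rewrite deg_to_seq.
have [|al' [be' [al'n be'n [al'D be'D] al'E be'E]]] :=
  ex n 0 _ (rpred0 _) (size_to_seq c) (rpred0 _) cD' (linear0 _).
  by rewrite linear0 dc.
have [x xE] := to_seqP al'n; have [y yE] := to_seqP be'n.
rewrite -xE deg_to_seq in al'D; rewrite -yE deg_to_seq in be'D.
exists (Submod al'D).
  case: n {c cD cc dc cD' al'n be' be'n be'D be'E y yE ex} x xE al'D => [//|n]
    x xE al'D.
  apply/eqP/val_inj; apply: (@to_seq_inj _ _ _ _ _ (bdry a x) 0).
  by rewrite to_seq_bdry xE al'E linear0.
exists (Submod be'D); apply: val_inj => /=; apply: to_seq_inj.
by rewrite linearB to_seq_push to_seq_bdry xE yE be'E addrC addKr.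
Qed.

End HomologyTranslation.

(* quandle_modules = false: modules over the multispindle X';
   quandle_modules = true: X' is a quandle and all modules are quandle modules,
   i.e. every map m |-> m * x is invertible *)
Theorem theorem5p8 (R : comPzRingType) (r : nat) (a : 'I_r -> R)
    (X X' : multispindle r) (phi : ms_hom X X') (M : xmodule R X')
    (quandle_modules : bool)
    (hX' : quandle_modules -> is_quandle X')
    (hM : quandle_modules -> has_invertible_action M)
    (hHN : forall n, bijective (HN_map a phi M n))
    (hHN_vanishing : forall N : xmodule R X',
       (quandle_modules -> has_invertible_action N) ->
       vanishing_compound a N ->
       forall n, bijective (HN_map a phi N n)) :
  forall n, bijective (HD_map a phi M n).
Proof.
apply: degen_exact_HD; apply: degen_exact_all; first exact: normal_exact_HN.
(* The hypothesis on vanishing compound actions is applied to the homology modules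
   [hommod a M l]. *)
move=> l; apply: normal_exact_HN; apply: hHN_vanishing.
  by move=> q; apply: hommod_invertible; [exact: hX' | exact: hM].
exact: hommod_vanishing.
Qed.
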